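(* Let $\tilde M$ be a Riemann-Cartan manifold. Then every smooth hypersurface embedded in $\tilde M$ is torsion-free if and only if one of the following three holds. (a) $\dim\tilde M\le2$. (b) $\dim\tilde M=3$ and the torsion of $\tilde M$ is totally skew-symmetric everywhere. (c) $\dim\tilde M\ge4$ and $\tilde M$ is torsion-free.
   Context: A Riemann-Cartan manifold is a Riemannian manifold endowed with a metric-compatible connection $\tilde\nabla$, possibly with torsion $\tilde T(X,Y)=\tilde\nabla_XY-\tilde\nabla_YX-[X,Y]$; it is torsion-free if its torsion vanishes everywhere. Its torsion is totally skew-symmetric if $(X,Y,Z)\mapsto\langle X,\tilde T(Y,Z)\rangle$ is alternating. A smooth hypersurface $M$ embedded in $\tilde M$ is itself a Riemann-Cartan manifold with the restricted metric and the projected connection $\nabla_XY=(\tilde\nabla_XY)^\top$ (tangential part); ''$M$ is torsion-free'' refers to this $\nabla$. *)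

(* Defs.v *)
From HB Require Import structures.
From mathcomp Require Import all_boot all_order all_algebra.
From mathcomp Require Import all_classical all_reals all_analysis.

Set Implicit Arguments.
Unset Strict Implicit.
Unset Printing Implicit Defensive.

Import Order.TTheory GRing.Theory Num.Theory.
Import numFieldNormedType.Exports.

Local Open Scope classical_set_scope.
Local Open Scope ring_scope.

(* In finite dimension this is the usual class C^k on the open set U: the
   directional derivatives 'D_v f in every direction v are again C^(k-1). *)
Fixpoint Ck {R : realType} {V W : normedModType R}
    (k : nat) (U : set V) (f : V -> W) : Prop :=
  match k with
  | 0 => forall x, U x -> {for x, continuous f}
  | k'.+1 => (forall x, U x -> differentiable f x) /\
             forall v : V, Ck k' U ('D_v f)
  end.

Definition Cinfty {R : realType} {V W : normedModType R}
    (U : set V) (f : V -> W) : Prop := forall k, Ck k U f.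

(* A homeomorphism from an open subset of T onto an open subset of R^n.  Both
   maps are total; their values off the domain, resp. off the image of the
   domain, are irrelevant. *)
Record chart (R : realType) (n : nat) (T : topologicalType) := Chart {
  cdom : set T;
  cmap : T -> 'rV[R]_n;
  cinv : 'rV[R]_n -> T;
  cdom_open : open cdom;
  cimg_open : open (cmap @` cdom);
  cmap_cont : forall p, cdom p -> {for p, continuous cmap};
  cinv_cont : forall x, (cmap @` cdom) x -> {for x, continuous cinv};
  cmapK : forall p, cdom p -> cinv (cmap p) = p
}.

Definition chart_compat (R : realType) (n : nat) (T : topologicalType)
    (phi psi : chart R n T) : Prop :=
  Cinfty (cmap phi @` (cdom phi `&` cdom psi)) (cmap psi \o cinv phi) /\
  Cinfty (cmap psi @` (cdom phi `&` cdom psi)) (cmap phi \o cinv psi).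

Record manifold (R : realType) (n : nat) := Manifold {
  carrier :> topologicalType;
  atlas : set (chart R n carrier);
  mfd_hausdorff : hausdorff_space carrier;
  mfd_second_countable : @second_countable carrier;
  atlas_cover : forall p : carrier, exists2 phi, atlas phi & cdom phi p;
  atlas_compat : forall phi psi, atlas phi -> atlas psi -> chart_compat phi psi
}.

Definition maximal_atlas (R : realType) (n : nat) (M : manifold R n) :
    set (chart R n M) :=
  [set phi | forall psi, atlas psi -> chart_compat phi psi].

Section Calculus.
Context {R : realType} {n : nat} (M : manifold R n).

Definition smooth_on (U : set M) (f : M -> R) : Prop :=
  forall phi : chart R n M, atlas phi ->
    Cinfty (cmap phi @` (cdom phi `&` U)) (f \o cinv phi).

Definition smooth_at (p : M) (f : M -> R) : Prop :=
  exists U : set M, [/\ open U, U p & smooth_on U f].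

(* Tangent vectors at p are represented by the operators f |-> v(f) on
   functions smooth near p.  [germ_op p D] sets the operator to 0 on the other
   functions, so that equality of tangent vectors is plain equality. *)
Definition oper : Type := (M -> R) -> R^o.

HB.instance Definition _ := GRing.Lmodule.on oper.

Definition germ_op (p : M) (D : oper) : oper :=
  fun f => if `[< smooth_at p f >] then D f else 0.

Definition tangent (p : M) : set oper :=
  [set v | exists (phi : chart R n M) (u : 'rV[R]_n),
     [/\ atlas phi, cdom phi p &
         v = germ_op p (fun f => 'D_u (f \o cinv phi) (cmap phi p))]].

(* A vector field over an open set U is a total function, whose values off U
   are irrelevant. *)
Definition vfield : Type := M -> oper.

Definition field_on (U : set M) (X : vfield) : Prop :=
  (forall p, U p -> tangent p (X p)) /\
  forall (V : set M) (f : M -> R), open V -> V `<=` U -> smooth_on V f ->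
    smooth_on V (fun q => X q f).

Definition addvf (X Y : vfield) : vfield := fun p => X p + Y p.
Definition scalevf (f : M -> R) (X : vfield) : vfield := fun p => f p *: X p.

Definition bracket (X Y : vfield) : vfield :=
  fun p => germ_op p (fun f => X p (fun q => Y q f) - Y p (fun q => X q f)).

Record is_metric (g : M -> oper -> oper -> R) : Prop := IsMetric {
  metric_linear : forall p (a : R) (u v w : oper),
    tangent p u -> tangent p v -> tangent p w ->
    g p (a *: u + v) w = a * g p u w + g p v w;
  metric_sym : forall p (v w : oper),
    tangent p v -> tangent p w -> g p v w = g p w v;
  metric_pos : forall p (v : oper), tangent p v -> v <> 0 -> 0 < g p v v;
  metric_smooth : forall (U : set M) (X Y : vfield),
    open U -> field_on U X -> field_on U Y ->
    smooth_on U (fun q => g q (X q) (Y q))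
}.

(* An affine connection, acting on vector fields over arbitrary open sets.
   Compatibility with restriction to smaller open sets follows from the last
   two axioms applied to the indicator function of the smaller set. *)
Record is_connection (D : vfield -> vfield -> vfield) : Prop := IsConnection {
  conn_field : forall (U : set M) (X Y : vfield),
    open U -> field_on U X -> field_on U Y -> field_on U (D X Y);
  conn_addl : forall (U : set M) (X X' Y : vfield),
    open U -> field_on U X -> field_on U X' -> field_on U Y ->
    forall p, U p -> D (addvf X X') Y p = D X Y p + D X' Y p;
  conn_addr : forall (U : set M) (X Y Y' : vfield),
    open U -> field_on U X -> field_on U Y -> field_on U Y' ->
    forall p, U p -> D X (addvf Y Y') p = D X Y p + D X Y' p;
  conn_scalel : forall (U : set M) (f : M -> R) (X Y : vfield),
    open U -> smooth_on U f -> field_on U X -> field_on U Y ->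
    forall p, U p -> D (scalevf f X) Y p = f p *: D X Y p;
  conn_leibniz : forall (U : set M) (f : M -> R) (X Y : vfield),
    open U -> smooth_on U f -> field_on U X -> field_on U Y ->
    forall p, U p -> D X (scalevf f Y) p = X p f *: Y p + f p *: D X Y p
}.

Definition metric_compatible (g : M -> oper -> oper -> R)
    (D : vfield -> vfield -> vfield) : Prop :=
  forall (U : set M) (X Y Z : vfield),
    open U -> field_on U X -> field_on U Y -> field_on U Z ->
    forall p, U p ->
      X p (fun q => g q (Y q) (Z q)) =
      g p (D X Y p) (Z p) + g p (Y p) (D X Z p).

Definition torsion (D : vfield -> vfield -> vfield) (X Y : vfield) : vfield :=
  fun p => D X Y p - D Y X p - bracket X Y p.

Definition torsion_free (D : vfield -> vfield -> vfield) : Prop :=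
  forall (U : set M) (X Y : vfield),
    open U -> field_on U X -> field_on U Y ->
    forall p, U p -> torsion D X Y p = 0.

(* The trilinear form (X, Y, Z) |-> <X, T(Y, Z)> is alternating on each tangent
   space: it vanishes as soon as two of the three tangent vectors agree. *)
Definition torsion_totally_skew (g : M -> oper -> oper -> R)
    (D : vfield -> vfield -> vfield) : Prop :=
  forall (U : set M) (X Y Z : vfield),
    open U -> field_on U X -> field_on U Y -> field_on U Z ->
    forall p, U p -> [\/ X p = Y p, Y p = Z p | X p = Z p] ->
      g p (X p) (torsion D Y Z p) = 0.

End Calculus.

Record riemann_cartan (R : realType) (n : nat) := RiemannCartan {
  rc_mfd :> manifold R n;
  rc_metric : rc_mfd -> oper rc_mfd -> oper rc_mfd -> R;
  rc_conn : vfield rc_mfd -> vfield rc_mfd -> vfield rc_mfd;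
  rc_metricP : is_metric rc_metric;
  rc_connP : is_connection rc_conn;
  rc_compat : metric_compatible rc_metric rc_conn
}.

Section Submanifold.
Context {R : realType} {m n : nat}.

(* iota embeds S as a submanifold of N: N has, around each point of the image,
   a slice chart phi in which the image is the coordinate subspace R^m x {0},
   and the first m coordinates of phi give a chart of S. *)
Definition embedding (S : manifold R m) (N : manifold R n) (iota : S -> N) :
    Prop :=
  injective iota /\
  forall q : S, exists (psi : chart R m S) (phi : chart R n N),
    [/\ maximal_atlas psi, maximal_atlas phi, cdom psi q,
        cdom psi = iota @^-1` cdom phi &
        (forall q', cdom psi q' -> forall j : 'I_n,
           (forall i : 'I_m, i = j :> nat ->
              cmap phi (iota q') 0 j = cmap psi q' 0 i) /\
           ((m <= j)%N -> cmap phi (iota q') 0 j = 0)) /\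
        (forall p, cdom phi p ->
           (forall j : 'I_n, (m <= j)%N -> cmap phi p 0 j = 0) ->
           range iota p)].

Definition hypersurface (S : manifold R m) (N : manifold R n) (iota : S -> N) :
    Prop := m.+1 = n /\ embedding iota.

Definition pushforward (S : manifold R m) (N : manifold R n) (iota : S -> N)
    (q : S) (v : oper S) : oper N :=
  germ_op (iota q) (fun f => v (f \o iota)).

Variables (S : manifold R m) (N : riemann_cartan R n) (iota : S -> N).

Definition extends (U : set S) (X : vfield S) (V : set N) (X' : vfield N) :
    Prop :=
  [/\ field_on U X, field_on V X', iota @` U `<=` V &
      forall q, U q -> X' (iota q) = pushforward iota q (X q)].

(* v in T_q S is the tangential part of w in T_(iota q) N. *)
Definition tangential_part (q : S) (w : oper N) (v : oper S) : Prop :=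
  tangent q v /\
  forall z, tangent q z ->
    rc_metric (iota q) (w - pushforward iota q v) (pushforward iota q z) = 0.

(* The projected connection (X, Y) |-> (D_X Y)^T, where D_X Y is computed from
   local extensions of X and Y to the ambient manifold. The result does not
   depend on the extensions; it is set to 0 at the points near which X or Y is
   not a smooth vector field. *)
Definition projected_connection (X Y : vfield S) : vfield S :=
  fun q => xget 0 [set v : oper S |
    exists (U : set S) (V : set N) (X' Y' : vfield N),
      [/\ open U /\ U q, open V, extends U X V X', extends U Y V Y' &
          tangential_part q (rc_conn X' Y' (iota q)) v]].

End Submanifold.

(* Main.v *)
Require Import Defs.
From mathcomp Require Import all_boot all_order all_algebra.
From mathcomp Require Import all_classical all_reals all_analysis.

(** Write [T] for the torsion of the ambient manifold. The connection of a
    hypersurface is the tangential part of the ambient one, and the bracket of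
    fields on the hypersurface is the bracket of their extensions; so the
    torsion of a hypersurface [S] is the tangential part of [T] restricted to
    [S] ([Gauss_torsion]). Since the metric is positive definite on the tangent
    space, [S] is torsion-free at a point iff the trilinear form
    [<Z, T(X, Y)>] vanishes on the vectors tangent to [S] there
    ([torsion_projected_eq0]).

    The theorem thereby becomes a question of linear algebra, because every
    hyperplane of every tangent space is tangent to some hypersurface: in a
    chart, a hyperplane through the point ([hyperplane_torsion]). Hence all
    hypersurfaces are torsion-free iff [<Z, T(X, Y)>] vanishes whenever
    [X, Y, Z] lie in a common hyperplane. As [T] is antisymmetric, this always
    holds if hyperplanes have dimension at most 1. If they have dimension 2,
    three vectors lie in a common hyperplane iff they are dependent, and the
    condition says that the form is alternating. In dimension at least 4 any
    three vectors lie in a common hyperplane; the choice [Z = T(X, Y)] gives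
    [T = 0].

    The first identity rests on coordinate formulas. A covariant derivative is
    expanded in the coordinate frame ([conn_frame]), which shows that it does
    not depend on the extensions of the fields off [S] ([conn_extends]) and
    that the torsion is a tensor ([torsion_tensorE]). That brackets are tangent
    vectors requires the symmetry of second derivatives ([Schwarz]), which is
    derived from the mean value theorem. *)

Set Implicit Arguments.
Unset Strict Implicit.
Unset Printing Implicit Defensive.

(* The definitions are imported again so that [addvf] and [pushforward] denote
   operations on vector fields rather than on subspaces and measures. *)
Import Defs Order.TTheory GRing.Theory Num.Theory.
Import numFieldNormedType.Exports.

Local Open Scope classical_set_scope.
Local Open Scope ring_scope.

(** * Calculus of C^k maps *)

Section Differentiability.
Context {R : realType} {V W : normedModType R}.
Implicit Types f g : V -> W.

(** Differentiability at [x] only depends on the germ at [x]: the differential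
    of [f] is a differential of [g], since the Landau remainders of both maps
    eventually coincide. *)
Lemma near_eq_differentiable f g (x : V) :
  (\forall y \near x, f y = g y) -> differentiable f x -> differentiable g x.
Proof.
move=> fg df; have fgx : f x = g x by exact: nbhs_singleton fg.
apply/diffP.
apply: (@getPex _ (fun (dg : {linear V -> W}) => continuous dg /\
  forall y, g y = g (lim (nbhs x)) + dg (y - lim (nbhs x))
                  +o_(y \near x) (y - lim (nbhs x)))).
exists ('d f x); split; first exact: diff_continuous.
have /diffE := df; rewrite lim_id // => /funext /eqaddoP dfo.
have /eqaddoP E : forall eps : R, 0 < eps -> \forall y \near nbhs_filter_on x,
    `|(g - (fun y => g x + 'd f x (y - x))) y| <= eps * `|y - x|.
  move=> eps eps0; have := dfo eps eps0; apply: filterS2 fg => y fgy.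
  by rewrite !fctE fgy fgx.
by move=> y; rewrite {1}E.
Qed.

Lemma near_eq_continuous f g (x : V) :
  (\forall y \near x, f y = g y) -> {for x, continuous f} -> {for x, continuous g}.
Proof.
move=> fg cf; rewrite /prop_for /continuous_at -(nbhs_singleton fg).
exact: cvg_trans (near_eq_cvg fg) cf.
Qed.

Lemma open_near_eq (U : set V) f g (x : V) :
  open U -> (forall y, U y -> f y = g y) -> U x -> \forall y \near x, f y = g y.
Proof. by move=> Uo fg Ux; apply: filterS (open_nbhs_nbhs (conj Uo Ux)). Qed.

End Differentiability.

Section CkBasic.
Context {R : realType} {V W : normedModType R}.
Implicit Types f g : V -> W.

Lemma Ck_eq k (U : set V) f g :
  open U -> (forall y, U y -> f y = g y) -> Ck k U f -> Ck k U g.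
Proof.
move=> Uo; elim: k f g => [|k IH] f g fg.
  by move=> cf x Ux; exact: near_eq_continuous (open_near_eq Uo fg Ux) (cf x Ux).
case=> df Df; split=> [x Ux|v].
  exact: near_eq_differentiable (open_near_eq Uo fg Ux) (df x Ux).
apply: IH (Df v) => y Uy; exact: near_eq_derive (open_near_eq Uo fg Uy).
Qed.

Lemma Ck_sub k (U U' : set V) f : U' `<=` U -> Ck k U f -> Ck k U' f.
Proof.
move=> UU'; elim: k f => [|k IH] f /=; first by move=> h x /UU'; exact: h.
by case=> df Df; split=> [x /UU'|v]; [exact: df|exact: IH].
Qed.

Lemma CkW k (U : set V) f : Ck k.+1 U f -> Ck k U f.
Proof.
elim: k f => [|k IH] f [df Df].
  by move=> x Ux; exact: differentiable_continuous (df x Ux).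
by split=> // v; exact: IH.
Qed.

Lemma Cinfty_sub (U U' : set V) f : U' `<=` U -> Cinfty U f -> Cinfty U' f.
Proof. by move=> UU' h k; exact: Ck_sub (h k). Qed.

Lemma Cinfty_eq (U : set V) f g :
  open U -> (forall y, U y -> f y = g y) -> Cinfty U f -> Cinfty U g.
Proof. by move=> Uo fg h k; exact: Ck_eq (h k). Qed.

(** Being C^k is a local property; this reduces statements about a whole atlas
    to a neighbourhood on which one further chart can be inserted. *)
Lemma Ck_bigcup k (U : set V) f : (forall x, U x -> exists2 N, N x & Ck k N f) ->
  Ck k U f.
Proof.
elim: k f => [|k IH] f h /=.
  by move=> x Ux; have [N Nx cf] := h x Ux; exact: cf.
split=> [x Ux|v]; first by have [N Nx [df _]] := h x Ux; exact: df.
by apply: IH => x Ux; have [N Nx [_ Df]] := h x Ux; exists N => //; exact: Df.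
Qed.

Lemma Cinfty_differentiable (U : set V) f x :
  Cinfty U f -> U x -> differentiable f x.
Proof. by move=> /(_ 1%N)[df _]; exact: df. Qed.

Lemma Cinfty_derive (U : set V) f v : Cinfty U f -> Cinfty U ('D_v f).
Proof. by move=> h k; case: (h k.+1) => _; exact. Qed.

Lemma Ck_cst k (U : set V) (c : W) : Ck k U (cst c).
Proof.
elim: k c => [|k IH] c /=; first by move=> x _; exact: cst_continuous.
split=> [x _|v]; first exact: differentiable_cst.
rewrite (_ : 'D_v (cst c) = cst 0) //.
by apply/funext => x; rewrite derive_cst.
Qed.

Lemma CkD k (U : set V) f g : open U -> Ck k U f -> Ck k U g -> Ck k U (f + g).
Proof.
move=> Uo; elim: k f g => [|k IH] f g.
  by move=> cf cg x Ux; apply: continuousD; [exact: cf|exact: cg].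
move=> [df Df] [dg Dg]; split=> [x Ux|v].
  by apply: differentiableD; [exact: df|exact: dg].
apply: (Ck_eq (f := 'D_v f + 'D_v g)) => //; last by apply: IH; [exact: Df|exact: Dg].
by move=> x Ux; rewrite deriveD //; apply: diff_derivable; [exact: df|exact: dg].
Qed.

Lemma Ck_sum k (U : set V) (I : Type) (s : seq I) (F : I -> V -> W) :
  open U -> (forall i, Ck k U (F i)) -> Ck k U (\sum_(i <- s) F i).
Proof.
move=> Uo h; elim: s => [|i s IH]; first by rewrite big_nil; exact: Ck_cst.
by rewrite big_cons; exact: CkD.
Qed.

Lemma CkZl k (U : set V) (c : V -> R) (w : W) :
  open U -> Ck k U c -> Ck k U (fun x => c x *: w).
Proof.
move=> Uo; elim: k c => [|k IH] c.
  by move=> cc x Ux; apply: continuousZr_tmp; exact: cc.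
move=> [dc Dc]; split=> [x Ux|v].
  by apply: differentiableZl; exact: dc.
apply: (Ck_eq (f := fun x => 'D_v c x *: w)) => //; last by apply: IH; exact: Dc.
move=> x Ux; rewrite !deriveE ?diffZl //; by [exact: dc|apply: differentiableZl; exact: dc].
Qed.

Lemma Ck_linear k (U : set V) (f : {linear V -> W}) :
  continuous f -> Ck k U f.
Proof.
move=> cf; case: k => [|k]; first by move=> x _; exact: cf.
split=> [x _|v]; first exact: linear_differentiable.
rewrite (_ : 'D_v f = cst (f v)); first exact: Ck_cst.
by apply/funext => x; rewrite deriveE ?diff_lin //; exact: linear_differentiable.
Qed.

End CkBasic.

Section CkScalar.
Context {R : realType} {V : normedModType R}.
Implicit Types f g : V -> R.

Lemma CkM k (U : set V) f g : open U -> Ck k U f -> Ck k U g -> Ck k U (f * g).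
Proof.
move=> Uo; elim: k f g => [|k IH] f g.
  by move=> cf cg x Ux; apply: continuousM; [exact: cf|exact: cg].
move=> cf cg; have [df Df] := cf; have [dg Dg] := cg; split=> [x Ux|v].
  by apply: differentiableM; [exact: df|exact: dg].
apply: (Ck_eq (f := f * 'D_v g + g * 'D_v f)) => //.
  by move=> x Ux; rewrite deriveM //; apply: diff_derivable; [exact: df|exact: dg].
by apply: CkD => //; apply: IH; by [exact: CkW|exact: Dg|exact: Df].
Qed.

End CkScalar.

Section CkComposition.
Context {R : realType}.

Lemma Ck_lin_comp (V W W' : normedModType R) (L : {linear W -> W'}) k
    (U : set V) (f : V -> W) : continuous L -> open U -> Ck k U f -> Ck k U (L \o f).
Proof.
move=> cL Uo; have dL y : differentiable L y by exact: linear_differentiable.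
elim: k f => [|k IH] f.
  by move=> cf x Ux; apply: continuous_comp; [exact: cf|exact: cL].
move=> [df Df]; split=> [x Ux|v].
  by apply: differentiable_comp; [exact: df|exact: dL].
apply: (Ck_eq (f := L \o 'D_v f)) => //; last by apply: IH; exact: Df.
move=> x Ux; have dfx := df x Ux.
rewrite [RHS]deriveE; last exact: differentiable_comp.
by rewrite diff_comp //= diff_lin // [in LHS]deriveE.
Qed.

Lemma Ck_coord (V : normedModType R) n k (U : set V) (f : V -> 'rV[R]_n) i :
  open U -> Ck k U f -> Ck k U (fun x => f x 0 i).
Proof.
move=> Uo cf.
have @L : {linear 'rV[R]_n -> R}.
  by exists (fun N : 'rV[R]_n => N 0 i); do 2![eexists]; do ?[constructor];
     rewrite ?mxE // => ? *; rewrite ?mxE//; move=> ?; rewrite !mxE.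
by apply: (@Ck_lin_comp V _ _ L) cf => //; exact: coord_continuous.
Qed.

Lemma Ck_row (V : normedModType R) n k (U : set V) (f : V -> 'rV[R]_n) :
  open U -> (forall i, Ck k U (fun x => f x 0 i)) -> Ck k U f.
Proof.
move=> Uo cf; rewrite (_ : f = \sum_i (fun x => f x 0 i *: 'e_i)).
  by apply: Ck_sum => // i; apply: CkZl.
by apply/funext => x; rewrite fct_sumE -row_sum_delta.
Qed.

Lemma derive_comp_row (V W : normedModType R) n (f : V -> 'rV[R]_n) (g : 'rV[R]_n -> W) x v :
  differentiable f x -> differentiable g (f x) ->
  'D_v (g \o f) x = \sum_i 'D_v f x 0 i *: 'D_('e_i) g (f x).
Proof.
move=> df dg; rewrite deriveE; last exact: differentiable_comp.
rewrite diff_comp //= -['d f x v]deriveE // [X in 'd g _ X]row_sum_delta linear_sum.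
by apply: eq_bigr => i _; rewrite linearZ -deriveE.
Qed.

(** Induction on [k] through the chain rule
    [D_v (g o f) = \sum_i (D_v f)_i * (D_(e_i) g o f)], in which [f] and the
    partial derivatives of [g] lose at most one order of regularity. *)
Lemma Ck_comp_scalar (V : normedModType R) n k (U : set V) (O : set 'rV[R]_n)
    (f : V -> 'rV[R]_n) (g : 'rV[R]_n -> R) :
  open U -> (forall x, U x -> O (f x)) ->
  Ck k U f -> Ck k O g -> Ck k U (g \o f).
Proof.
move=> Uo fO; elim: k g => [|k IH] g.
  by move=> cf cg x Ux; apply: continuous_comp; [exact: cf|apply: cg; exact: fO].
move=> cf; have [df Df] := cf; move=> [dg Dg]; split=> [x Ux|v].
  by apply: differentiable_comp; [exact: df|apply: dg; exact: fO].
apply: (Ck_eq (f := \sum_i ((fun x => 'D_v f x 0 i) * ('D_('e_i) g \o f)))) => //.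
  move=> x Ux; rewrite fct_sumE derive_comp_row //; first exact: df.
  exact/dg/fO.
apply: Ck_sum => // i; apply: CkM => //; first by apply: Ck_coord => //; exact: Df.
by apply: IH; [exact: CkW|exact: Dg].
Qed.

Lemma Ck_comp (V : normedModType R) n p k (U : set V) (O : set 'rV[R]_n)
    (f : V -> 'rV[R]_n) (g : 'rV[R]_n -> 'rV[R]_p) :
  open U -> open O -> (forall x, U x -> O (f x)) ->
  Ck k U f -> Ck k O g -> Ck k U (g \o f).
Proof.
move=> Uo Oo fO cf cg; apply: Ck_row => // i.
by apply: (@Ck_comp_scalar _ _ _ _ O f (fun y => g y 0 i)) => //; exact: Ck_coord.
Qed.

Lemma Ck_id (V : normedModType R) k (U : set V) : Ck k U id.
Proof. by apply: (@Ck_linear _ _ _ _ _ idfun) => x; exact: cvg_id. Qed.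

Lemma Ck_mulmxr n p k (U : set 'rV[R]_n) (A : 'M[R]_(n, p)) :
  open U -> Ck k U (fun x => x *m A).
Proof.
move=> Uo; rewrite (_ : (fun x => x *m A) = \sum_i (fun x : 'rV_n => x 0 i *: row i A)).
  by apply: Ck_sum => // i; apply: CkZl => //; apply: Ck_coord => //; exact: Ck_id.
by apply/funext => x; rewrite fct_sumE mulmx_sum_row.
Qed.

Lemma Cinfty_affine n p (U : set 'rV[R]_n) (A : 'M[R]_(n, p)) b :
  open U -> Cinfty U (fun x => x *m A + b).
Proof.
by move=> Uo k; apply: CkD => //; [exact: Ck_mulmxr|exact: Ck_cst].
Qed.

Lemma affine_continuous n p (A : 'M[R]_(n, p)) b :
  continuous (fun x : 'rV[R]_n => x *m A + b).
Proof. by move=> x; apply: (@Cinfty_affine n p setT A b openT 0%N). Qed.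

Lemma Cinfty_comp (V : normedModType R) n p (U : set V) (O : set 'rV[R]_n)
    (f : V -> 'rV[R]_n) (g : 'rV[R]_n -> 'rV[R]_p) :
  open U -> open O -> (forall x, U x -> O (f x)) ->
  Cinfty U f -> Cinfty O g -> Cinfty U (g \o f).
Proof. by move=> Uo Oo fO cf cg k; exact: Ck_comp (cf k) (cg k). Qed.

Lemma Cinfty_comp_scalar (V : normedModType R) n (U : set V) (O : set 'rV[R]_n)
    (f : V -> 'rV[R]_n) (g : 'rV[R]_n -> R) :
  open U -> (forall x, U x -> O (f x)) ->
  Cinfty U f -> Cinfty O g -> Cinfty U (g \o f).
Proof. by move=> Uo fO cf cg k; exact: Ck_comp_scalar (cf k) (cg k). Qed.
End CkComposition.

(** * Symmetry of second derivatives *)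

Section Schwarz.
Context {R : realType} {V : normedModType R}.
Implicit Types f g : V -> R.

Lemma MVT_line g (x w : V) (h : R) : 0 < h ->
  (forall s, 0 <= s <= h -> differentiable g (x + s *: w)) ->
  exists2 c, 0 < c < h & g (x + h *: w) - g x = 'D_w g (x + c *: w) * h.
Proof.
move=> h0 dg.
pose l (s : R) : V := x + s *: w.
have dl (s : R) : is_diff s l (fun t => t *: w).
  by apply: is_diff_eq; rewrite add0r.
have dgl (s : R) : 0 <= s <= h -> differentiable (g \o l) s.
  by move=> sh; apply: differentiable_comp; [exact: ex_diff|exact: dg].
have Dgl (s : R) : s \in `]0, h[%R -> is_derive s 1 (g \o l) ('D_w g (l s)).
  rewrite in_itv /= => /andP[s0 sh].
  have sh' : 0 <= s <= h by rewrite !ltW.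
  apply: DeriveDef; first exact/diff_derivable/dgl.
  rewrite [LHS]deriveE; last exact: dgl.
  have dgs : differentiable g (l s) by exact: dg.
  have dls : differentiable l s by exact: ex_diff.
  rewrite (diff_comp dls dgs) /= diff_val scale1r.
  by rewrite [RHS]deriveE.
have [|c] := MVT h0 Dgl.
  apply: continuous_in_subspaceT => s; rewrite inE /= in_itv /= => sh.
  exact/differentiable_continuous/dgl.
by rewrite in_itv /= => ch; rewrite /l scale0r addr0 subr0 => E; exists c.
Qed.

(** The mean value theorem is applied once along [u] to the increment
    [y |-> f (y + h v) - f y], then once along [v] to the derivative of [f]
    along [u]. *)
Lemma mixed_difference (U : set V) f (x u v : V) (h : R) : 0 < h ->
  Ck 2 U f ->
  (forall s t, 0 <= s <= h -> 0 <= t <= h -> U (x + s *: u + t *: v)) ->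
  exists s t, [/\ 0 < s < h, 0 < t < h &
    f (x + h *: u + h *: v) - f (x + h *: u) - (f (x + h *: v) - f x) =
    'D_v ('D_u f) (x + s *: u + t *: v) * h * h].
Proof.
move=> h0 [df Df] Ux.
have hh : 0 <= h <= h by rewrite lexx ltW.
have h00 : (0 : R) <= 0 <= h by rewrite lexx ltW.
pose g y := f (y + h *: v) - f y.
have dsh y : is_diff y (fun z => z + h *: v) id.
  by apply: is_diff_eq; rewrite addr0.
have dfs y : U (y + h *: v) -> differentiable (f \o (fun z => z + h *: v)) y.
  by move=> Uy; apply: differentiable_comp; [exact: ex_diff|exact: df].
have dg (s : R) : 0 <= s <= h -> differentiable g (x + s *: u).
  move=> sh; apply: differentiableB; first exact/dfs/Ux.
  by have := Ux s 0 sh h00; rewrite scale0r addr0 => /df.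
have [s sh Es] := MVT_line h0 dg.
have sh' : 0 <= s <= h by case/andP: sh => s0 s1; rewrite !ltW.
have dDf (t : R) : 0 <= t <= h -> differentiable ('D_u f) (x + s *: u + t *: v).
  by move=> th; have [+ _] := Df u; apply; exact: Ux.
have [t th Et] := MVT_line h0 dDf.
exists s, t; split=> //.
rewrite -/(g (x + h *: u)) -/(g x) Es -Et; congr (_ * _).
have Us := Ux s 0 sh' h00; rewrite scale0r addr0 in Us.
have Uh := Ux s h sh' hh.
rewrite deriveB; [|exact/diff_derivable/dfs|exact/diff_derivable/df].
congr (_ - _).
rewrite [LHS]deriveE; last exact: dfs.
have ds : differentiable (fun z => z + h *: v) (x + s *: u) by exact: ex_diff.
rewrite (diff_comp ds (df _ Uh)) /= diff_val [RHS]deriveE //.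
exact: df.
Qed.

Lemma eq_by_approx (a b : R) :
  (forall e, 0 < e -> exists c d, [/\ c = d, `|a - c| < e & `|b - d| < e]) -> a = b.
Proof.
move=> h; apply/eqP; rewrite -subr_eq0 -normr_le0; apply/ler_addgt0Pl => e e0.
have [|c [d [<- ac bc]]] := h (e / 2); first by rewrite divr_gt0.
rewrite addr0 -(subrKA c) (le_trans (ler_normD _ _)) // (splitr e).
by apply: ltW; rewrite ltrD // distrC.
Qed.

(** The mixed second difference of [f] is symmetric in [u] and [v], so by
    [mixed_difference] it is, up to the factor [h ^+ 2], a value of either mixed
    derivative near [x]; continuity at [x] then identifies the two. *)
Lemma Schwarz (U : set V) f (x u v : V) : open U -> U x -> Ck 2 U f ->
  'D_u ('D_v f) x = 'D_v ('D_u f) x.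
Proof.
move=> Uo Ux cf.
have cD a b : {for x, continuous ('D_a ('D_b f))}.
  by have [_ Df] := cf; have [_ DDf] := Df b; exact: DDf.
apply: eq_by_approx => e e0.
have [d /= d0 xd] : exists2 d : R, 0 < d & forall y, `|x - y| < d ->
   [/\ U y, `|'D_u ('D_v f) x - 'D_u ('D_v f) y| < e
     & `|'D_v ('D_u f) x - 'D_v ('D_u f) y| < e].
  suff : \forall y \near x, [/\ U y, `|'D_u ('D_v f) x - 'D_u ('D_v f) y| < e
     & `|'D_v ('D_u f) x - 'D_v ('D_u f) y| < e].
    by move=> /nbhs_normP[d /= d0 xd]; exists d => // y xy; apply: xd.
  have /cvgrPdist_lt/(_ _ e0) c1 := cD u v.
  have /cvgrPdist_lt/(_ _ e0) c2 := cD v u.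
  apply: filterS3 (open_nbhs_nbhs (conj Uo Ux)) c1 c2 => y; exact: And3.
(* [h] is such that the parallelogram spanned by [h u] and [h v] stays in the
   ball of radius [d]; the [+ 1] keeps [K] positive when [u = v = 0]. *)
pose K := `|u| + `|v| + 1.
have K0 : 0 < K by rewrite ltr_wpDl // addr_ge0.
pose h := d / K; have h0 : 0 < h by rewrite divr_gt0.
have small a b (s t : R) : 0 <= s <= h -> 0 <= t <= h -> `|a| + `|b| < K ->
    `|x - (x + s *: a + t *: b)| < d.
  move=> /andP[s0 sh] /andP[t0 th] abK.
  rewrite -addrA opprD addrA subrr add0r normrN.
  apply: le_lt_trans (ler_normD _ _) _; rewrite !normrZ !ger0_norm //.
  apply: (@le_lt_trans _ _ (h * (`|a| + `|b|))).
    by rewrite mulrDr lerD // ler_wpM2r.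
  by rewrite -[ltRHS](divfK (lt0r_neq0 K0)) -/h ltr_pM2l.
have uvK : `|u| + `|v| < K by rewrite /K ltrDl.
have vuK : `|v| + `|u| < K by rewrite [ltLHS]addrC.
have [|s [t [sh th E1]]] := mixed_difference (x := x) (u := u) (v := v) h0 cf.
  by move=> s t sh th; have [] := xd _ (small _ _ s t sh th uvK).
have [|s' [t' [sh' th' E2]]] := mixed_difference (x := x) (u := v) (v := u) h0 cf.
  by move=> s' t' sh' th'; have [] := xd _ (small _ _ s' t' sh' th' vuK).
have W (s0 : R) : 0 < s0 < h -> 0 <= s0 <= h.
  by case/andP => ? ?; rewrite !ltW.
have [_ _ D1] := xd _ (small _ _ _ _ (W _ sh) (W _ th) uvK).
have [_ D2 _] := xd _ (small _ _ _ _ (W _ sh') (W _ th') vuK).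
exists ('D_u ('D_v f) (x + s' *: v + t' *: u)), ('D_v ('D_u f) (x + s *: u + t *: v)).
split; [|exact: D2|exact: D1].
apply: (mulIf (lt0r_neq0 h0)); apply: (mulIf (lt0r_neq0 h0)).
apply: (etrans (esym E2)); apply: (etrans _ E1).
have swap (a b c k : R) : a - b - (c - k) = a - c - (b - k).
  by rewrite !opprD !opprK !addrA; congr (_ + _); exact: addrAC.
by rewrite (addrAC x (h *: v) (h *: u)); exact: swap.
Qed.
End Schwarz.

(** * Charts and smooth functions *)

Section Charts.
Context {R : realType} {n : nat} {M : manifold R n}.
Implicit Types (phi psi chi : chart R n M) (U V : set M) (f g : M -> R) (p q : M).

Lemma atlas_maximal phi : atlas phi -> maximal_atlas phi.
Proof. by move=> Aphi psi; exact: atlas_compat. Qed.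

Lemma maximal_chart_at p : exists2 phi : chart R n M, maximal_atlas phi & cdom phi p.
Proof. by have [phi /atlas_maximal ? ?] := atlas_cover p; exists phi. Qed.

Lemma chart_image_open phi U : open U -> open (cmap phi @` (cdom phi `&` U)).
Proof.
move=> Uo; rewrite (_ : _ @` _ = (cmap phi @` cdom phi) `&` cinv phi @^-1` U).
  rewrite openE => x [[q dq qx] Ux]; rewrite /interior.
  have ix : (cmap phi @` cdom phi) x by exists q.
  apply: filterI; first by apply: open_nbhs_nbhs; split; [exact: cimg_open|].
  by apply: (cinv_cont ix); apply: open_nbhs_nbhs.
apply/seteqP; split=> [_ [q [dq Uq] <-]|_ [[q dq <-] Uq]].
  by split; [exists q|rewrite /= cmapK].
by exists q => //; split=> //; rewrite /= cmapK in Uq.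
Qed.

Lemma near_chart phi U p : open U -> cdom phi p -> U p ->
  \forall y \near cmap phi p, (cmap phi @` (cdom phi `&` U)) y.
Proof.
by move=> Uo dp Up; apply: open_nbhs_nbhs; split; [exact: chart_image_open|exists p].
Qed.

Lemma chart_preimage_open phi (O : set 'rV[R]_n) :
  open O -> open (cdom phi `&` cmap phi @^-1` O).
Proof.
move=> Oo; rewrite openE => q [dq Oq]; apply: filterI.
  by apply: open_nbhs_nbhs; split; [exact: cdom_open|].
by apply: (cmap_cont dq); apply: open_nbhs_nbhs.
Qed.

(** Smoothness read in the chart [chi] passes to the chart [phi] because
    [f o phi^-1 = (f o chi^-1) o (chi o phi^-1)] over a common domain. *)
Lemma chart_transfer phi chi U f : open U -> U `<=` cdom phi -> U `<=` cdom chi ->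
  Cinfty (cmap phi @` (cdom phi `&` cdom chi)) (cmap chi \o cinv phi) ->
  Cinfty (cmap chi @` U) (f \o cinv chi) -> Cinfty (cmap phi @` U) (f \o cinv phi).
Proof.
move=> Uo Uphi Uchi tr ff.
have oU : open (cmap phi @` U) by rewrite -(setIidr Uphi); exact: chart_image_open.
apply: (@Cinfty_eq _ _ _ _ ((f \o cinv chi) \o (cmap chi \o cinv phi))) => //.
  by move=> _ [q Uq <-] /=; rewrite !cmapK //; [exact: Uphi|exact: Uchi|exact: Uphi].
apply: (Cinfty_comp_scalar (O := cmap chi @` U)) => //.
  by move=> _ [q Uq <-] /=; exists q => //; rewrite cmapK //; exact: Uphi.
by apply: Cinfty_sub tr => _ [q Uq <-]; exists q => //; split; [exact: Uphi|exact: Uchi].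
Qed.

Lemma smooth_on_sub U V f : V `<=` U -> smooth_on U f -> smooth_on V f.
Proof.
move=> VU sf phi Aphi; apply: Cinfty_sub (sf phi Aphi).
by move=> _ [q [dq Vq] <-]; exists q => //; split=> //; exact: VU.
Qed.

Lemma smooth_on_eq U f g : open U -> (forall q, U q -> f q = g q) ->
  smooth_on U f -> smooth_on U g.
Proof.
move=> Uo fg sf phi Aphi; apply: Cinfty_eq (sf phi Aphi); first exact: chart_image_open.
by move=> _ [q [dq Uq] <-] /=; rewrite cmapK // fg.
Qed.

Lemma smooth_on_cst U (c : R) : smooth_on U (fun=> c).
Proof. by move=> phi _ k; exact: Ck_cst. Qed.

Lemma smooth_onD U f g : open U -> smooth_on U f -> smooth_on U g ->
  smooth_on U (fun q => f q + g q).
Proof.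
move=> Uo sf sg phi Aphi k.
apply: (@CkD _ _ _ _ _ (f \o cinv phi) (g \o cinv phi)) => //; last 2 first.
- exact: sf.
- exact: sg.
exact: chart_image_open.
Qed.

Lemma smooth_onM U f g : open U -> smooth_on U f -> smooth_on U g ->
  smooth_on U (fun q => f q * g q).
Proof.
move=> Uo sf sg phi Aphi k.
apply: (@CkM _ _ _ _ (f \o cinv phi) (g \o cinv phi)) => //; last 2 first.
- exact: sf.
- exact: sg.
exact: chart_image_open.
Qed.

Lemma smooth_on_sum U (I : Type) (s : seq I) (F : I -> M -> R) : open U ->
  (forall i, smooth_on U (F i)) -> smooth_on U (fun q => \sum_(i <- s) F i q).
Proof.
move=> Uo sF; elim: s => [|i s IH].
  by apply: smooth_on_eq (smooth_on_cst U 0) => // q _; rewrite big_nil.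
apply: smooth_on_eq (smooth_onD Uo (sF i) IH) => // q _.
by rewrite big_cons.
Qed.

Lemma smooth_at_on U f p : open U -> U p -> smooth_on U f -> smooth_at p f.
Proof. by move=> Uo Up sf; exists U. Qed.

Lemma smooth_at_near U f g p : open U -> U p -> (forall q, U q -> f q = g q) ->
  smooth_at p f -> smooth_at p g.
Proof.
move=> Uo Up fg [V [Vo Vp sf]]; exists (U `&` V); split=> //; first exact: openI.
apply: (@smooth_on_eq _ f); [exact: openI|by move=> q []/fg|].
by apply: smooth_on_sub sf => q [].
Qed.

(** The charts of the maximal atlas see the same smooth functions as those of
    the atlas. This matters because slice charts of an embedding, and the
    affine modifications of a chart, only belong to the maximal atlas. *)
Lemma smooth_on_chart phi U f : open U -> maximal_atlas phi -> smooth_on U f ->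
  Cinfty (cmap phi @` (cdom phi `&` U)) (f \o cinv phi).
Proof.
move=> Uo Mphi sf k; apply: Ck_bigcup => _ [q [dq Uq] <-].
have [chi Achi dcq] := atlas_cover q.
pose W := cdom phi `&` U `&` cdom chi.
exists (cmap phi @` W); first by exists q.
suff : Cinfty (cmap phi @` W) (f \o cinv phi) by exact.
apply: (@chart_transfer phi chi); last 2 first.
- by have [] := Mphi chi Achi.
- by apply: Cinfty_sub (sf chi Achi) => _ [r [[? ?] ?] <-]; exists r.
- by apply: openI; [apply: openI => //|]; exact: cdom_open.
- by move=> r [[]].
- by move=> r [].
Qed.

Lemma smooth_on_of_chart phi U f : open U -> U `<=` cdom phi -> maximal_atlas phi ->
  Cinfty (cmap phi @` U) (f \o cinv phi) -> smooth_on U f.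
Proof.
move=> Uo Uphi Mphi sf chi Achi.
apply: (@chart_transfer chi phi).
- by apply: openI => //; exact: cdom_open.
- by move=> r [].
- by move=> r [_ /Uphi].
- by have [_] := Mphi chi Achi; rewrite setIC.
- by apply: Cinfty_sub sf => _ [r [? ?] <-]; exists r.
Qed.

Lemma smooth_on_coord phi j : maximal_atlas phi ->
  smooth_on (cdom phi) (fun q => cmap phi q 0 j).
Proof.
move=> Mphi chi Achi l; apply: (@Ck_coord _ _ _ _ _ (cmap phi \o cinv chi)).
  by apply: chart_image_open; exact: cdom_open.
by have [_] := Mphi chi Achi; rewrite setIC; apply.
Qed.

(** Two charts of the maximal atlas need not be compatible by definition; they
    are, because the coordinates of one are smooth functions, hence smooth in
    the other. *)
Lemma maximal_transition phi psi : maximal_atlas phi -> maximal_atlas psi ->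
  Cinfty (cmap phi @` (cdom phi `&` cdom psi)) (cmap psi \o cinv phi).
Proof.
move=> Mphi Mpsi k; apply: Ck_row => [|j].
  by apply: chart_image_open; exact: cdom_open.
by have /(smooth_on_chart (cdom_open psi) Mphi)/(_ k) := smooth_on_coord j Mpsi.
Qed.

End Charts.

(** * Tangent vectors *)

Section TangentVectors.
Context {R : realType} {n : nat} {M : manifold R n}.
Implicit Types (phi psi : chart R n M) (U V : set M) (f g : M -> R) (p q : M).
Implicit Types (u v : 'rV[R]_n) (a b c : oper M).

Lemma operD a b f : (a + b) f = a f + b f. Proof. by []. Qed.
Lemma operZ (k : R) a f : (k *: a) f = k * (a f : R). Proof. by []. Qed.
Lemma oper_sum (I : Type) (s : seq I) (F : I -> oper M) f :
  (\sum_(i <- s) F i) f = \sum_(i <- s) F i f.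
Proof. by elim: s => [|i s IH]; rewrite ?big_nil // !big_cons operD IH. Qed.

(** The tangent vector at [p] with coordinates [u] in the chart [phi]. *)
Definition tvec phi p u : oper M :=
  germ_op p (fun f => 'D_u (f \o cinv phi) (cmap phi p)).

Lemma germ_opE p (D : oper M) f : smooth_at p f -> germ_op p D f = D f.
Proof. by move=> sf; rewrite /germ_op asboolT. Qed.

Lemma germ_opN p (D : oper M) f : ~ smooth_at p f -> germ_op p D f = 0.
Proof. by move=> sf; rewrite /germ_op asboolF. Qed.

Lemma germ_op_eq p (D D' : oper M) :
  (forall f, smooth_at p f -> D f = D' f) -> germ_op p D = germ_op p D'.
Proof.
move=> h; apply/funext => f; have [sf|sf] := pselect (smooth_at p f).
  by rewrite !germ_opE // h.
by rewrite !germ_opN.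
Qed.

Lemma smooth_at_Cinfty phi p f : maximal_atlas phi -> cdom phi p -> smooth_at p f ->
  exists2 N, open_nbhs (cmap phi p) N & Cinfty N (f \o cinv phi).
Proof.
move=> Mphi dp [U [Uo Up sf]]; exists (cmap phi @` (cdom phi `&` U)).
  by split; [exact: chart_image_open|exists p].
exact: smooth_on_chart.
Qed.

Lemma smooth_at_differentiable phi p f : maximal_atlas phi -> cdom phi p ->
  smooth_at p f -> differentiable (f \o cinv phi) (cmap phi p).
Proof.
by move=> Mphi dp /(smooth_at_Cinfty Mphi dp)[N [_ Np]] /Cinfty_differentiable; apply.
Qed.

Lemma tvecE phi p u f : smooth_at p f ->
  tvec phi p u f = 'D_u (f \o cinv phi) (cmap phi p).
Proof. by move=> sf; rewrite /tvec germ_opE. Qed.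

Lemma tvec_linear phi p (k : R) u v : maximal_atlas phi -> cdom phi p ->
  tvec phi p (k *: u + v) = k *: tvec phi p u + tvec phi p v.
Proof.
move=> Mphi dp; apply/funext => f.
rewrite operD operZ.
have [sf|sf] := pselect (smooth_at p f); last first.
  by rewrite /tvec !germ_opN // mulr0 addr0.
have df := smooth_at_differentiable Mphi dp sf.
by rewrite !tvecE // !(deriveE _ df) linearP.
Qed.

Lemma tvecD phi p u v : maximal_atlas phi -> cdom phi p ->
  tvec phi p (u + v) = tvec phi p u + tvec phi p v.
Proof. by move=> Mphi dp; rewrite -[u]scale1r tvec_linear // !scale1r. Qed.

Lemma tvec0 phi p : maximal_atlas phi -> cdom phi p -> tvec phi p 0 = 0.
Proof.
move=> Mphi dp; apply: (@addrI _ (tvec phi p 0)).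
by rewrite -tvecD // !addr0.
Qed.

Lemma tvecZ phi p (k : R) u : maximal_atlas phi -> cdom phi p ->
  tvec phi p (k *: u) = k *: tvec phi p u.
Proof. by move=> Mphi dp; rewrite -[k *: u]addr0 tvec_linear // tvec0 // addr0. Qed.

Lemma tvec_sum phi p (I : Type) (s : seq I) (F : I -> 'rV[R]_n) :
  maximal_atlas phi -> cdom phi p ->
  tvec phi p (\sum_(i <- s) F i) = \sum_(i <- s) tvec phi p (F i).
Proof.
move=> Mphi dp; elim: s => [|i s IH]; first by rewrite !big_nil tvec0.
by rewrite !big_cons tvecD // IH.
Qed.

(** The Jacobian of the transition map acts on coordinates, by the chain rule. *)
Lemma tvec_change phi psi p u :
  maximal_atlas phi -> maximal_atlas psi -> cdom phi p -> cdom psi p ->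
  tvec phi p u = tvec psi p ('D_u (cmap psi \o cinv phi) (cmap phi p)).
Proof.
move=> Mphi Mpsi dp ep; apply: germ_op_eq => f sf.
have ip : (cmap phi @` (cdom phi `&` cdom psi)) (cmap phi p) by exists p.
have dt := Cinfty_differentiable (maximal_transition Mphi Mpsi) ip.
have df := smooth_at_differentiable Mpsi ep sf.
have E : (cmap psi \o cinv phi) (cmap phi p) = cmap psi p by rewrite /= cmapK.
rewrite (near_eq_derive (g := (f \o cinv psi) \o (cmap psi \o cinv phi))); last first.
  have := near_chart (cdom_open psi) dp ep.
  by apply: filterS => _ [q [dq eq] <-] /=; rewrite !cmapK.
rewrite -E in df *.
rewrite [LHS]deriveE; last exact: differentiable_comp.
by rewrite (diff_comp dt df) /= -[X in 'd _ _ X = _](deriveE _ dt) -(deriveE _ df).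
Qed.

Lemma tangent_tvec phi p u : maximal_atlas phi -> cdom phi p -> tangent p (tvec phi p u).
Proof.
move=> Mphi dp; have [chi Achi ep] := atlas_cover p.
rewrite (tvec_change _ Mphi (atlas_maximal Achi)) //.
by exists chi, ('D_u (cmap chi \o cinv phi) (cmap phi p)).
Qed.

(** Together with [tangent_tvec] and [tvec_inj]: any single chart of the maximal
    atlas identifies the tangent space with [R^n]. *)
Lemma tangentP phi p a : maximal_atlas phi -> cdom phi p -> tangent p a ->
  exists u, a = tvec phi p u.
Proof.
move=> Mphi dp [psi [u [Apsi ep ->]]].
exists ('D_u (cmap phi \o cinv psi) (cmap psi p)).
by rewrite -tvec_change //; exact: atlas_maximal.
Qed.

Lemma tangent_linear p (k : R) a b : tangent p a -> tangent p b -> tangent p (k *: a + b).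
Proof.
have [phi Mphi dp] := maximal_chart_at p.
move=> /(tangentP Mphi dp)[u ->] /(tangentP Mphi dp)[v ->].
by rewrite -tvec_linear //; exact: tangent_tvec.
Qed.

Lemma tangent0 p : tangent p (0 : oper M).
Proof.
have [phi Mphi dp] := maximal_chart_at p.
by rewrite -(tvec0 Mphi dp); exact: tangent_tvec.
Qed.

Lemma tangentD p a b : tangent p a -> tangent p b -> tangent p (a + b).
Proof. by move=> ta tb; rewrite -[a]scale1r; exact: tangent_linear. Qed.

Lemma tangentZ p (k : R) a : tangent p a -> tangent p (k *: a).
Proof. by move=> ta; rewrite -[_ *: _]addr0; apply: tangent_linear => //; exact: tangent0. Qed.

Lemma tangentB p a b : tangent p a -> tangent p b -> tangent p (a - b).
Proof. by move=> ta tb; rewrite -scaleN1r addrC; exact: tangent_linear. Qed.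

Lemma tangent_sum p (I : Type) (s : seq I) (F : I -> oper M) :
  (forall i, tangent p (F i)) -> tangent p (\sum_(i <- s) F i).
Proof.
move=> tF; elim: s => [|i s IH]; first by rewrite big_nil; exact: tangent0.
by rewrite big_cons; exact: tangentD.
Qed.

Lemma tangent_germ p a : tangent p a -> exists D, a = germ_op p D.
Proof. by case=> phi [u [_ _ ->]]; eexists. Qed.

(** A tangent vector acts on germs. The case of a function that is not smooth at
    [p] is covered, since both values are then [0]. *)
Lemma tangent_near U p a f g : tangent p a -> open U -> U p ->
  (forall q, U q -> f q = g q) -> a f = a g.
Proof.
have [phi Mphi dp] := maximal_chart_at p.
move=> /(tangentP Mphi dp)[u ->] Uo Up fg.
have [sf|sf] := pselect (smooth_at p f); last first.
  rewrite /tvec !germ_opN // => sg; apply: sf; apply: (smooth_at_near Uo Up _ sg).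
  by move=> q /fg.
rewrite !tvecE //; last exact: (smooth_at_near Uo Up fg sf).
apply: near_eq_derive; have := near_chart Uo dp Up.
by apply: filterS => _ [q [dq Uq] <-] /=; rewrite cmapK // fg.
Qed.

Lemma tangent_nonsmooth p a f : tangent p a -> ~ smooth_at p f -> a f = 0.
Proof. by move=> /tangent_germ[D ->] sf; exact: germ_opN. Qed.

Lemma tangent_derivation p a f g : tangent p a -> smooth_at p f -> smooth_at p g ->
  a (fun q => f q * g q) = f p * a g + g p * a f.
Proof.
have [phi Mphi dp] := maximal_chart_at p.
move=> /(tangentP Mphi dp)[u ->] sf sg.
have sfg : smooth_at p (fun q => f q * g q).
  have [U [Uo Up cf]] := sf; have [V [Vo Vp cg]] := sg.
  exists (U `&` V); split=> //; first exact: openI.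
  apply: smooth_onM; first exact: openI.
    by apply: smooth_on_sub cf => q [].
  by apply: smooth_on_sub cg => q [].
rewrite !tvecE //.
rewrite (@deriveM _ _ (f \o cinv phi) (g \o cinv phi)).
- by rewrite /= cmapK.
- exact/diff_derivable/smooth_at_differentiable.
- exact/diff_derivable/smooth_at_differentiable.
Qed.

Lemma tangent_additive p a f g : tangent p a -> smooth_at p f -> smooth_at p g ->
  a (fun q => f q + g q) = a f + a g.
Proof.
have [phi Mphi dp] := maximal_chart_at p.
move=> /(tangentP Mphi dp)[u ->] sf sg.
have sfg : smooth_at p (fun q => f q + g q).
  have [U [Uo Up cf]] := sf; have [V [Vo Vp cg]] := sg.
  exists (U `&` V); split=> //; first exact: openI.
  apply: smooth_onD; first exact: openI.
    by apply: smooth_on_sub cf => q [].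
  by apply: smooth_on_sub cg => q [].
rewrite !tvecE //.
rewrite (@deriveD _ _ _ (f \o cinv phi) (g \o cinv phi)) //.
- exact/diff_derivable/smooth_at_differentiable.
- exact/diff_derivable/smooth_at_differentiable.
Qed.

Lemma tangent_cst p a (k : R) : tangent p a -> a (fun=> k) = 0.
Proof.
have [phi Mphi dp] := maximal_chart_at p.
move=> /(tangentP Mphi dp)[u ->]; rewrite tvecE; last first.
  by exists setT; split=> //; [exact: openT|exact: smooth_on_cst].
exact: derive_cst.
Qed.

Lemma tangent_fsum p a (I : Type) (s : seq I) (F : I -> M -> R) (U : set M) :
  tangent p a -> open U -> U p -> (forall i, smooth_on U (F i)) ->
  a (fun q => \sum_(i <- s) F i q) = \sum_(i <- s) a (F i).
Proof.
move=> ta Uo Up sF; elim: s => [|i s IH].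
  by rewrite big_nil -[RHS](tangent_cst 0 ta); congr (a _); apply/funext => q; rewrite big_nil.
rewrite big_cons -IH -(tangent_additive ta); last 2 first.
- exact: smooth_at_on (sF i).
- by apply: (@smooth_at_on _ _ _ U) => //; exact: smooth_on_sum.
by congr (a _); apply/funext => q; rewrite big_cons.
Qed.

Definition coord_fun phi j : M -> R := fun q => cmap phi q 0 j.

Lemma coord_fun_smooth_at phi j p : maximal_atlas phi -> cdom phi p ->
  smooth_at p (coord_fun phi j).
Proof.
by move=> Mphi dp; apply: smooth_at_on (smooth_on_coord j Mphi) => //; exact: cdom_open.
Qed.

Lemma tvec_coord phi p u j : maximal_atlas phi -> cdom phi p ->
  tvec phi p u (coord_fun phi j) = u 0 j.
Proof.
move=> Mphi dp; rewrite tvecE; last exact: coord_fun_smooth_at.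
rewrite (near_eq_derive (g := fun y : 'rV[R]_n => id y 0 j)); last first.
  have := near_chart openT dp I.
  by apply: filterS => _ [q [dq _] <-] /=; rewrite /coord_fun cmapK.
have did : derivable (@id 'rV[R]_n) (cmap phi p) u by exact: derivable_id.
have := derive_mx did; rewrite derive_id => /matrixP/(_ 0 j).
by rewrite mxE.
Qed.

Lemma tvec_inj phi p u v : maximal_atlas phi -> cdom phi p ->
  tvec phi p u = tvec phi p v -> u = v.
Proof.
move=> Mphi dp E; apply/rowP => j.
by rewrite -(tvec_coord u j Mphi dp) E tvec_coord.
Qed.

Definition coords phi a : 'rV[R]_n := \row_j (a (coord_fun phi j) : R).

Lemma coords_tvec phi p u : maximal_atlas phi -> cdom phi p -> coords phi (tvec phi p u) = u.
Proof. by move=> Mphi dp; apply/rowP => j; rewrite mxE tvec_coord. Qed.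

Lemma coordsK phi p a : maximal_atlas phi -> cdom phi p -> tangent p a ->
  tvec phi p (coords phi a) = a.
Proof. by move=> Mphi dp /(tangentP Mphi dp)[u ->]; rewrite coords_tvec. Qed.

Lemma tvec_delta phi p u : maximal_atlas phi -> cdom phi p ->
  tvec phi p u = \sum_j u 0 j *: tvec phi p 'e_j.
Proof.
move=> Mphi dp; rewrite {1}(row_sum_delta u) tvec_sum //.
by apply: eq_bigr => j _; rewrite tvecZ.
Qed.

(** The coordinates of a tangent vector are its values on the coordinate
    functions; all later computations of vectors go through this expansion. *)
Lemma tangent_delta phi p a : maximal_atlas phi -> cdom phi p -> tangent p a ->
  a = \sum_j (a (coord_fun phi j) : R) *: tvec phi p 'e_j.
Proof.
move=> Mphi dp ta; rewrite -{1}(coordsK Mphi dp ta) tvec_delta //.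
by apply: eq_bigr => j _; rewrite mxE.
Qed.

End TangentVectors.

(** * Vector fields and brackets *)

Section Fields.
Context {R : realType} {n : nat} {M : manifold R n}.
Implicit Types (phi psi : chart R n M) (U V W : set M) (f g : M -> R) (p q : M).
Implicit Types (u v : 'rV[R]_n) (a b c : oper M) (X Y Z : vfield M).

Lemma field_on_sub U V X : V `<=` U -> field_on U X -> field_on V X.
Proof.
move=> VU [tX sX]; split=> [p /VU|W f Wo WV]; first exact: tX.
by apply: sX => // q /WV/VU.
Qed.

Lemma field_on_eq U X Y : (forall q, U q -> X q = Y q) -> field_on U X -> field_on U Y.
Proof.
move=> XY [tX sX]; split=> [p Up|W f Wo WU sf]; first by rewrite -XY //; exact: tX.
by apply: smooth_on_eq (sX W f Wo WU sf) => // q /WU/XY ->.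
Qed.

Lemma field_on_scale U f X : smooth_on U f -> field_on U X -> field_on U (scalevf f X).
Proof.
move=> sf [tX sX]; split=> [p Up|W g Wo WU sg]; first exact/tangentZ/tX.
by apply: smooth_onM => //; [exact: smooth_on_sub sf|exact: sX].
Qed.

Lemma field_on_add U X Y : field_on U X -> field_on U Y -> field_on U (addvf X Y).
Proof.
move=> [tX sX] [tY sY]; split=> [p Up|W g Wo WU sg].
  by apply: tangentD; [exact: tX|exact: tY].
by apply: smooth_onD => //; [exact: sX|exact: sY].
Qed.

Lemma field_on0 U : field_on U (fun=> 0).
Proof.
by split=> [p _|W f Wo _ _]; [exact: tangent0|exact: smooth_on_cst].
Qed.

Lemma field_on_sum U (I : Type) (s : seq I) (F : I -> vfield M) :
  (forall i, field_on U (F i)) -> field_on U (fun q => \sum_(i <- s) F i q).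
Proof.
move=> FF; elim: s => [|i s IH].
  by apply: field_on_eq (field_on0 U) => q _; rewrite big_nil.
by apply: field_on_eq (field_on_add (FF i) IH) => q _; rewrite big_cons.
Qed.

(** The coordinate field d/dx_j of the chart [phi]. *)
Definition frame phi j : vfield M := fun q => tvec phi q 'e_j.

Lemma frame_field phi j : maximal_atlas phi -> field_on (cdom phi) (frame phi j).
Proof.
move=> Mphi; split=> [p dp|W f Wo Wphi sf]; first exact: tangent_tvec.
apply: (smooth_on_of_chart Wo Wphi Mphi).
have E := setIidr Wphi; have oW : open (cmap phi @` W).
  by rewrite -E; exact: chart_image_open.
apply: (@Cinfty_eq _ _ _ _ ('D_('e_j) (f \o cinv phi))) => //.
  move=> _ [q Wq <-] /=; rewrite cmapK; last exact: Wphi.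
  by rewrite /frame tvecE //; exact: smooth_at_on sf.
by apply: Cinfty_derive; rewrite -E; exact: smooth_on_chart.
Qed.

Lemma field_on_coord U phi X j :
  open U -> U `<=` cdom phi -> maximal_atlas phi -> field_on U X ->
  smooth_on U (fun q => X q (coord_fun phi j)).
Proof.
move=> Uo Uphi Mphi [_ sX]; apply: sX => //.
by apply: smooth_on_sub (smooth_on_coord j Mphi).
Qed.

Lemma field_frame U phi X q : U `<=` cdom phi -> maximal_atlas phi -> field_on U X -> U q ->
  X q = \sum_j scalevf (fun r => X r (coord_fun phi j)) (frame phi j) q.
Proof.
move=> Uphi Mphi [tX _] Uq; rewrite {1}(tangent_delta Mphi (Uphi _ Uq) (tX _ Uq)).
by [].
Qed.

Lemma field_of_coords U phi (x : M -> 'rV[R]_n) : U `<=` cdom phi -> maximal_atlas phi ->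
  (forall j, smooth_on U (fun q => x q 0 j)) -> field_on U (fun q => tvec phi q (x q)).
Proof.
move=> Uphi Mphi sx.
apply: (@field_on_eq _ (fun q => \sum_j scalevf (fun q => x q 0 j) (frame phi j) q)).
  by move=> q Uq; rewrite tvec_delta //; exact: Uphi.
apply: field_on_sum => j; apply: field_on_scale => //.
exact: field_on_sub (frame_field j Mphi).
Qed.

(** Coordinate fields commute: in the chart this is Schwarz. *)
Lemma frame_comm phi i j p f : maximal_atlas phi -> cdom phi p -> smooth_at p f ->
  frame phi i p (fun q => frame phi j q f) = frame phi j p (fun q => frame phi i q f).
Proof.
move=> Mphi dp [U [Uo Up sf]].
pose W := U `&` cdom phi.
have Wo : open W by apply: openI => //; exact: cdom_open.
have sW : smooth_on W f by apply: smooth_on_sub sf => q [].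
have oW : open (cmap phi @` W) by rewrite /W setIC; exact: chart_image_open.
have cf : Cinfty (cmap phi @` W) (f \o cinv phi).
  by rewrite /W setIC; exact: smooth_on_chart.
have E k l : frame phi k p (fun q => frame phi l q f) =
    'D_('e_k) ('D_('e_l) (f \o cinv phi)) (cmap phi p).
  have Fl := field_on_sub (@subIsetr _ U (cdom phi)) (frame_field l Mphi).
  rewrite /frame tvecE; last first.
    by apply: (@smooth_at_on _ _ _ W) => //; have [_] := Fl; apply.
  apply: near_eq_derive.
  apply: (@filterS _ _ _ (cmap phi @` W)); last by apply: open_nbhs_nbhs; split=> //; exists p.
  move=> _ [q [Uq dq] <-] /=; rewrite cmapK // tvecE //.
  by apply: (@smooth_at_on _ _ _ W).
rewrite !E; apply: (@Schwarz _ _ (cmap phi @` W)) => //.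
by exists p.
Qed.

Lemma field_derive_frame U phi X p f : maximal_atlas phi -> cdom phi p -> U p ->
  field_on U X -> X p f = \sum_j (X p (coord_fun phi j) : R) * (frame phi j p f : R).
Proof.
move=> Mphi dp Up [tX _].
by rewrite {1}(tangent_delta Mphi dp (tX _ Up)) oper_sum.
Qed.

(** Expanding [Y] in the coordinate frame splits [X (Y f)] into a first-order
    part and a second-order part. The latter is symmetric in [X] and [Y] by
    [frame_comm], hence disappears from the bracket. *)
Lemma field_second_derivative phi U X Y p f :
  maximal_atlas phi -> cdom phi p -> open U -> U p -> field_on U X -> field_on U Y ->
  smooth_at p f ->
  X p (fun q => Y q f) =
   \sum_j (X p (fun q => Y q (coord_fun phi j)) : R) * (frame phi j p f : R) +
   \sum_j \sum_i ((X p (coord_fun phi i) : R) * (Y p (coord_fun phi j) : R)) *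
          (frame phi i p (fun q => frame phi j q f) : R).
Proof.
move=> Mphi dp Uo Up FX FY [V [Vo Vp sf]].
pose W := U `&` cdom phi `&` V.
have Wo : open W by do ?apply: openI => //; exact: cdom_open.
have Wp : W p by [].
have WU : W `<=` U by move=> q [[]].
have Wphi : W `<=` cdom phi by move=> q [[]].
have sW : smooth_on W f by apply: smooth_on_sub sf => q [].
have [tX _] := FX; have tXp := tX p Up.
have FYW := field_on_sub WU FY; have [_ sYW] := FYW.
have sE j : smooth_on W (fun q => frame phi j q f).
  by have [_] := frame_field j Mphi; apply.
have sY j : smooth_on W (fun q => Y q (coord_fun phi j)) by exact: field_on_coord.
rewrite (tangent_near (U := W) tXp
  (g := fun q => \sum_j (Y q (coord_fun phi j) : R) * (frame phi j q f : R))) //; last first.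
  by move=> q Wq; apply: (@field_derive_frame W) => //; exact: Wphi.
rewrite (tangent_fsum (U := W) _ tXp) //; last by move=> j; exact: smooth_onM.
rewrite -big_split; apply: eq_bigr => j _ /=.
rewrite (tangent_derivation tXp); last 2 first.
- exact: smooth_at_on (sY j).
- exact: smooth_at_on (sE j).
rewrite [LHS]addrC; congr (_ + _); first exact: mulrC.
rewrite {1}(tangent_delta Mphi dp tXp) oper_sum mulr_sumr; apply: eq_bigr => i _.
by rewrite operZ mulrCA mulrA.
Qed.

Lemma bracket_frame phi U X Y p :
  maximal_atlas phi -> cdom phi p -> open U -> U p -> field_on U X -> field_on U Y ->
  bracket X Y p = \sum_j ((X p (fun q => Y q (coord_fun phi j)) : R)
                         - (Y p (fun q => X q (coord_fun phi j)) : R)) *: frame phi j p.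
Proof.
move=> Mphi dp Uo Up FX FY; apply/funext => f.
have [sf|sf] := pselect (smooth_at p f); last first.
  rewrite /bracket germ_opN // (@tangent_nonsmooth _ _ _ p) //.
  by apply: tangent_sum => j; apply: tangentZ; exact: tangent_tvec.
rewrite /bracket germ_opE // !(field_second_derivative Mphi dp Uo Up) // oper_sum.
rewrite opprD addrACA -sumrB.
rewrite [X in _ + X](_ : _ = 0) ?addr0; last first.
  apply/eqP; rewrite subr_eq0; apply/eqP; rewrite exchange_big /=.
  apply: eq_bigr => i _; apply: eq_bigr => j _.
  by rewrite frame_comm // [_ * (Y p _ : R)]mulrC.
by apply: eq_bigr => j _; rewrite operZ mulrBl.
Qed.

(** The metric is only controlled on tangent vectors, so the torsion can be
    paired with other vectors only once its bracket term is known to be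
    tangent. *)
Lemma tangent_bracket U X Y p : open U -> U p -> field_on U X -> field_on U Y ->
  tangent p (bracket X Y p).
Proof.
move=> Uo Up FX FY; have [phi Mphi dp] := maximal_chart_at p.
rewrite (bracket_frame Mphi dp Uo Up FX FY).
by apply: tangent_sum => j; apply: tangentZ; exact: tangent_tvec.
Qed.

End Fields.

(** * Connections and the torsion tensor *)

Lemma addr_cancel_difference (V : zmodType) (s t a b : V) :
  s + a - (t + b) - (s - t) = a - b.
Proof. by rewrite [- (t + b)]opprD addrACA [LHS]addrC addrA addNr add0r. Qed.

Section Connections.
Context {R : realType} {n : nat} {M : manifold R n}.
Variable D : vfield M -> vfield M -> vfield M.
Hypothesis HD : is_connection D.
Implicit Types (phi psi : chart R n M) (U V W : set M) (f g : M -> R) (p q : M).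
Implicit Types (X Y Z : vfield M) (a b c : oper M).

(** Multiplying a field by the indicator function of an open set, which is
    smooth on that set, forgets its values elsewhere; this is how locality
    follows from the algebraic axioms of a connection. *)
Definition indic_fun W : M -> R := fun q => if `[< W q >] then 1 else 0.

Lemma indic_fun1 W q : W q -> indic_fun W q = 1.
Proof. by move=> Wq; rewrite /indic_fun asboolT. Qed.

Lemma indic_fun_smooth W : open W -> smooth_on W (indic_fun W).
Proof.
move=> Wo; apply: smooth_on_eq (smooth_on_cst W 1) => // q Wq.
by rewrite indic_fun1.
Qed.

Lemma scalevf_indic W X X' : (forall q, W q -> X q = X' q) ->
  scalevf (indic_fun W) X = scalevf (indic_fun W) X'.
Proof.
move=> XX'; apply/funext => q; rewrite /scalevf /indic_fun.
by case: asboolP => [/XX' ->//|_]; rewrite !scale0r.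
Qed.

Lemma conn_locall W X X' Y p : open W -> W p -> (forall q, W q -> X q = X' q) ->
  field_on W X -> field_on W Y -> D X Y p = D X' Y p.
Proof.
move=> Wo Wp XX' FX FY; have FX' := field_on_eq XX' FX.
have sW := indic_fun_smooth Wo.
have := conn_scalel HD Wo sW FX FY Wp; have := conn_scalel HD Wo sW FX' FY Wp.
by rewrite (scalevf_indic XX') indic_fun1 // !scale1r => -> ->.
Qed.

Lemma conn_localr W X Y Y' p : open W -> W p -> (forall q, W q -> Y q = Y' q) ->
  field_on W X -> field_on W Y -> D X Y p = D X Y' p.
Proof.
move=> Wo Wp YY' FX FY; have FY' := field_on_eq YY' FY.
have sW := indic_fun_smooth Wo.
have := conn_leibniz HD Wo sW FX FY Wp; have := conn_leibniz HD Wo sW FX FY' Wp.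
have -> : X p (indic_fun W) = 0.
  have tX : tangent p (X p) by have [tX _] := FX; exact: tX.
  rewrite -[RHS](tangent_cst 1 tX); apply: (tangent_near (U := W) tX) => // q Wq.
  by rewrite indic_fun1.
by rewrite (scalevf_indic YY') indic_fun1 // !scale0r !scale1r !add0r => -> ->.
Qed.

Lemma conn0l W Y p : open W -> W p -> field_on W Y -> D (fun=> 0) Y p = 0.
Proof.
move=> Wo Wp FY.
have := conn_scalel HD Wo (smooth_on_cst W 0) (field_on0 W) FY Wp.
by rewrite scale0r (_ : scalevf _ _ = fun=> 0) //; apply/funext => q; rewrite /scalevf scale0r.
Qed.

Lemma conn0r W X p : open W -> W p -> field_on W X -> D X (fun=> 0) p = 0.
Proof.
move=> Wo Wp FX.
have := conn_leibniz HD Wo (smooth_on_cst W 0) FX (field_on0 W) Wp.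
rewrite scale0r scaler0 addr0 (_ : scalevf _ _ = fun=> 0) //.
by apply/funext => q; rewrite /scalevf scale0r.
Qed.

Lemma conn_suml W (I : Type) (s : seq I) (F : I -> vfield M) Y p :
  open W -> W p -> (forall i, field_on W (F i)) -> field_on W Y ->
  D (fun q => \sum_(i <- s) F i q) Y p = \sum_(i <- s) D (F i) Y p.
Proof.
move=> Wo Wp FF FY; elim: s => [|i s IH].
  rewrite big_nil -[RHS](conn0l Wo Wp FY); congr (D _ _ _).
  by apply/funext => q; rewrite big_nil.
rewrite big_cons -IH -(conn_addl HD Wo (FF i) (field_on_sum s FF) FY Wp).
by congr (D _ _ _); apply/funext => q; rewrite big_cons.
Qed.

Lemma conn_sumr W (I : Type) (s : seq I) (F : I -> vfield M) X p :
  open W -> W p -> (forall i, field_on W (F i)) -> field_on W X ->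
  D X (fun q => \sum_(i <- s) F i q) p = \sum_(i <- s) D X (F i) p.
Proof.
move=> Wo Wp FF FX; elim: s => [|i s IH].
  rewrite big_nil -[RHS](conn0r Wo Wp FX); congr (D _ _ _).
  by apply/funext => q; rewrite big_nil.
rewrite big_cons -IH -(conn_addr HD Wo FX (FF i) (field_on_sum s FF) Wp).
by congr (D _ _ _); apply/funext => q; rewrite big_cons.
Qed.

(** The coordinate expression of a covariant derivative, with the fields
    [D (frame phi i) (frame phi j)] in the role of the Christoffel symbols. It
    involves [X] only through [X p], and [Y] only through its coordinates at
    [p] and their derivatives along [X p]. *)
Lemma conn_frame phi U X Y p :
  maximal_atlas phi -> cdom phi p -> open U -> U p -> field_on U X -> field_on U Y ->
  D X Y p =
    \sum_j (X p (fun q => Y q (coord_fun phi j)) : R) *: frame phi j p +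
    \sum_j \sum_i ((X p (coord_fun phi i) : R) * (Y p (coord_fun phi j) : R)) *:
       D (frame phi i) (frame phi j) p.
Proof.
move=> Mphi dp Uo Up FX FY; pose W := U `&` cdom phi.
have Wo : open W by apply: openI => //; exact: cdom_open.
have Wp : W p by [].
have Wphi : W `<=` cdom phi by move=> q [].
have FXW : field_on W X by apply: field_on_sub FX => q [].
have FYW : field_on W Y by apply: field_on_sub FY => q [].
have FE j : field_on W (frame phi j) by apply: field_on_sub Wphi (frame_field j Mphi).
have sc Z j : field_on W Z -> smooth_on W (fun q => Z q (coord_fun phi j)).
  by move=> FZ; exact: field_on_coord.
have FsE Z j : field_on W Z ->
    field_on W (scalevf (fun q => Z q (coord_fun phi j)) (frame phi j)).
  by move=> FZ; apply: field_on_scale => //; exact: sc.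
rewrite (conn_localr Wo Wp (fun q => field_frame Wphi Mphi FYW (q := q)) FXW FYW).
rewrite (conn_sumr _ Wo Wp (fun j => FsE Y j FYW) FXW) -big_split /=.
apply: eq_bigr => j _; rewrite (conn_leibniz HD Wo (sc Y j FYW) FXW (FE j) Wp).
congr (_ + _).
rewrite (conn_locall Wo Wp (fun q => field_frame Wphi Mphi FXW (q := q)) FXW (FE j)).
rewrite (conn_suml _ Wo Wp (fun j => FsE X j FXW) (FE j)) scaler_sumr.
apply: eq_bigr => i _; rewrite (conn_scalel HD Wo (sc X i FXW) (FE i) (FE j) Wp).
by rewrite scalerA mulrC.
Qed.

(** The torsion as a bilinear map on the tangent space at [p]: coordinate fields
    have no bracket, so its components are the antisymmetrized Christoffel
    symbols. *)
Definition torsion_tensor phi p a b : oper M :=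
  \sum_i \sum_j ((a (coord_fun phi i) : R) * (b (coord_fun phi j) : R)) *:
    (D (frame phi i) (frame phi j) p - D (frame phi j) (frame phi i) p).

Lemma antisym_split (V : lmodType R) (x y : 'I_n -> R) (G : 'I_n -> 'I_n -> V) :
  \sum_j \sum_i (x i * y j) *: G i j - \sum_j \sum_i (y i * x j) *: G i j =
  \sum_i \sum_j (x i * y j) *: (G i j - G j i).
Proof.
rewrite exchange_big /= -sumrB; apply: eq_bigr => i _.
rewrite -sumrB; apply: eq_bigr => j _.
by rewrite scalerBr [y j * _]mulrC.
Qed.

(** The derivatives of the coordinates of [X] and [Y] in [D X Y - D Y X] are
    exactly those that make up the bracket. *)
Lemma torsion_tensorE phi U X Y p :
  maximal_atlas phi -> cdom phi p -> open U -> U p -> field_on U X -> field_on U Y ->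
  torsion D X Y p = torsion_tensor phi p (X p) (Y p).
Proof.
move=> Mphi dp Uo Up FX FY; rewrite /torsion (bracket_frame Mphi dp Uo Up FX FY).
rewrite !(conn_frame Mphi dp Uo Up) // /torsion_tensor.
rewrite -(antisym_split (fun i => X p (coord_fun phi i)) (fun i => Y p (coord_fun phi i))
  (fun i j => D (frame phi i) (frame phi j) p)).
under [X in _ - X]eq_bigr do rewrite scalerBl.
by rewrite sumrB; exact: addr_cancel_difference.
Qed.

Lemma tangent_torsion_tensor phi p a b : maximal_atlas phi -> cdom phi p ->
  tangent p (torsion_tensor phi p a b).
Proof.
move=> Mphi dp; apply: tangent_sum => i; apply: tangent_sum => j; apply: tangentZ.
have FE k := frame_field k Mphi.
have H k l : tangent p (D (frame phi k) (frame phi l) p).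
  by have [tD _] := conn_field HD (cdom_open phi) (FE k) (FE l); exact: tD.
exact: tangentB.
Qed.

Lemma torsion_tensor_linearl phi p (k : R) a a' b :
  torsion_tensor phi p (k *: a + a') b =
  k *: torsion_tensor phi p a b + torsion_tensor phi p a' b.
Proof.
rewrite /torsion_tensor scaler_sumr -big_split; apply: eq_bigr => i _ /=.
rewrite scaler_sumr -big_split; apply: eq_bigr => j _ /=.
by rewrite operD operZ mulrDl scalerDl scalerA mulrA.
Qed.

Lemma torsion_tensor_antisym phi p a b :
  torsion_tensor phi p a b = - torsion_tensor phi p b a.
Proof.
rewrite /torsion_tensor exchange_big /= -sumrN; apply: eq_bigr => i _.
rewrite -sumrN; apply: eq_bigr => j _.
by rewrite -scalerN opprB mulrC.
Qed.

Lemma torsion_tensor_alt phi p a : torsion_tensor phi p a a = 0.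
Proof.
have E := torsion_tensor_antisym phi p a a.
have : (2%:R : R) *: torsion_tensor phi p a a = 0.
  by rewrite scaler_nat mulr2n {1}E addNr.
by move/eqP; rewrite scaler_eq0 pnatr_eq0 /= => /eqP.
Qed.
End Connections.

(** * Slice charts of a submanifold *)

Section LinearMaps.
Context {R : realType}.

Lemma derive_mulmxr n p (A : 'M[R]_(n, p)) (x v : 'rV[R]_n) :
  'D_v (fun y => y *m A) x = v *m A.
Proof.
have cA : continuous (mulmxr A : {linear 'rV[R]_n -> 'rV[R]_p}).
  by move=> y; exact: (@Ck_mulmxr _ n p 0 setT A openT).
have dA : differentiable (mulmxr A : {linear 'rV[R]_n -> 'rV[R]_p}) x.
  exact: linear_differentiable.
by have := deriveE v dA; rewrite diff_lin.
Qed.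

Lemma mulmxr_continuous n p (A : 'M[R]_(n, p)) : continuous (fun y : 'rV[R]_n => y *m A).
Proof. by move=> y; exact: (@Ck_mulmxr _ n p 0 setT A openT). Qed.

Lemma mulmxr_differentiable n p (A : 'M[R]_(n, p)) (x : 'rV[R]_n) :
  differentiable (fun y : 'rV[R]_n => y *m A) x.
Proof. by have [+ _] := @Ck_mulmxr _ n p 1 setT A openT; apply. Qed.

Lemma pid_mx_padE m n (y : 'rV[R]_m) (j : 'I_n) (i : 'I_m) : i = j :> nat ->
  (y *m (pid_mx m : 'M[R]_(m, n))) 0 j = y 0 i.
Proof.
move=> ij; rewrite mxE (bigD1 i) //= mxE ij eqxx -ij ltn_ord mulr1 big1 ?addr0 // => k ki.
rewrite mxE (_ : (k == j :> nat) = false) ?mulr0 //.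
by rewrite -ij; apply/negbTE.
Qed.

Lemma pid_mx_pad0 m n (y : 'rV[R]_m) (j : 'I_n) : (m <= j)%N ->
  (y *m (pid_mx m : 'M[R]_(m, n))) 0 j = 0.
Proof.
move=> mj; rewrite mxE big1 // => k _.
rewrite mxE (_ : (k == j :> nat) = false) ?mulr0 //.
by apply/negbTE; rewrite neq_ltn (leq_trans (ltn_ord k)).
Qed.

(** Multiplication by [pid_mx m] pads a row vector with zeros when [m <= n], and
    drops the last coordinates in the opposite direction. Being matrix
    products, both operations are visibly linear and smooth. *)
Lemma pid_mx_padP m n (x : 'rV[R]_n) (y : 'rV[R]_m) :
  (forall j : 'I_n, (forall i : 'I_m, i = j :> nat -> x 0 j = y 0 i) /\
     ((m <= j)%N -> x 0 j = 0)) -> x = y *m pid_mx m.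
Proof.
move=> h; apply/rowP => j; have [h1 h2] := h j.
have [mj|jm] := leqP m j; first by rewrite h2 // pid_mx_pad0.
by rewrite (h1 (Ordinal jm)) // (pid_mx_padE y (i := Ordinal jm)).
Qed.

Lemma pid_mx_padK m n (y : 'rV[R]_m) : (m <= n)%N ->
  (y *m (pid_mx m : 'M[R]_(m, n))) *m (pid_mx m : 'M[R]_(n, m)) = y.
Proof.
move=> mn; rewrite -mulmxA mul_pid_mx minnn (minn_idPr _) //.
by rewrite pid_mx_1 mulmx1.
Qed.

End LinearMaps.

Section Slice.
Context {R : realType} {m n : nat}.
Hypothesis le_mn : (m <= n)%N.
Variables (S : manifold R m) (N : manifold R n) (iota : S -> N).

Record slice_chart (psi : chart R m S) (phi : chart R n N) : Prop := SliceChart {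
  slice_source : maximal_atlas psi;
  slice_target : maximal_atlas phi;
  slice_dom : cdom psi = iota @^-1` cdom phi;
  slice_map : forall q, cdom psi q -> cmap phi (iota q) = cmap psi q *m pid_mx m
}.

Lemma embedding_slice : embedding iota -> forall q, exists psi phi,
  slice_chart psi phi /\ cdom psi q.
Proof.
move=> [_ He] q; have [psi [phi [Mpsi Mphi dq dom [h _]]]] := He q.
exists psi, phi; split=> //; split=> // q' dq'.
by apply: pid_mx_padP; exact: h.
Qed.

Variables (psi : chart R m S) (phi : chart R n N).
Hypothesis Hs : slice_chart psi phi.
Let Mpsi := slice_source Hs.
Let Mphi := slice_target Hs.

Lemma slice_domE q : cdom psi q -> cdom phi (iota q).
Proof. by rewrite (slice_dom Hs). Qed.

Lemma slice_preimage_open (V : set N) : open V -> open (cdom psi `&` iota @^-1` V).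
Proof.
move=> Vo.
rewrite (_ : _ `&` _ = cdom psi `&` cmap psi @^-1`
   ((fun y => y *m pid_mx m) @^-1` (cmap phi @` (cdom phi `&` V)))).
  apply: chart_preimage_open; apply: open_comp; last exact: chart_image_open.
  by move=> y _; exact: mulmxr_continuous.
apply/seteqP; split=> q [dq Vq]; split=> //=.
  by rewrite -(slice_map Hs dq); exists (iota q) => //; split=> //; exact: slice_domE.
case: Vq => p [dp Vp]; rewrite -(slice_map Hs dq) => /(congr1 (cinv phi)).
by rewrite !cmapK //; [move=> <-|exact: slice_domE].
Qed.

Lemma slice_cinv_pad q : cdom psi q -> cinv phi (cmap psi q *m pid_mx m) = iota q.
Proof. by move=> dq; rewrite -(slice_map Hs dq) cmapK //; exact: slice_domE. Qed.

Lemma smooth_on_pullback (V : set N) f : open V -> smooth_on V f ->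
  smooth_on (cdom psi `&` iota @^-1` V) (f \o iota).
Proof.
move=> Vo sf; have Wo := slice_preimage_open Vo.
apply: (smooth_on_of_chart Wo _ Mpsi); first by move=> q [].
have oW : open (cmap psi @` (cdom psi `&` iota @^-1` V)).
  rewrite (_ : _ `&` _ = cdom psi `&` (cdom psi `&` iota @^-1` V)).
    exact: chart_image_open.
  by rewrite setIA setIid.
apply: (@Cinfty_eq _ _ _ _ ((f \o cinv phi) \o (fun y => y *m pid_mx m))) => //.
  by move=> _ [q [dq Vq] <-] /=; rewrite slice_cinv_pad // cmapK.
apply: (Cinfty_comp_scalar (O := cmap phi @` (cdom phi `&` V))) => //.
- move=> _ [q [dq Vq] <-]; rewrite -(slice_map Hs dq); exists (iota q) => //.
  by split=> //; exact: slice_domE.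
- by move=> k; exact: Ck_mulmxr.
- exact: smooth_on_chart.
Qed.

Lemma smooth_at_pullback q f : cdom psi q -> smooth_at (iota q) f -> smooth_at q (f \o iota).
Proof.
move=> dq [V [Vo Vq sf]]; exists (cdom psi `&` iota @^-1` V); split=> //.
  exact: slice_preimage_open.
exact: smooth_on_pullback.
Qed.

Lemma pushforwardE q (v : oper S) f : smooth_at (iota q) f ->
  pushforward iota q v f = v (f \o iota).
Proof. by move=> sf; rewrite /pushforward germ_opE. Qed.

(** In slice charts the inclusion is the zero padding, which is its own
    derivative. *)
Lemma pushforward_tvec q u : cdom psi q ->
  pushforward iota q (tvec psi q u) = tvec phi (iota q) (u *m pid_mx m).
Proof.
move=> dq; apply: germ_op_eq => f sf; rewrite tvecE; last exact: smooth_at_pullback.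
have df := smooth_at_differentiable Mphi (slice_domE dq) sf.
have dp := mulmxr_differentiable (pid_mx m : 'M[R]_(m, n)) (cmap psi q).
rewrite (near_eq_derive (g := (f \o cinv phi) \o (fun y => y *m pid_mx m))); last first.
  have := near_chart openT dq I.
  by apply: filterS => _ [r [dr _] <-] /=; rewrite slice_cinv_pad // cmapK.
rewrite (slice_map Hs dq) in df *.
rewrite [LHS]deriveE; last exact: differentiable_comp.
rewrite (diff_comp dp df) /= -[X in 'd _ _ X = _](deriveE _ dp) derive_mulmxr.
by rewrite -(deriveE _ df).
Qed.

Lemma pushforward_tangent q v : cdom psi q -> tangent q v ->
  tangent (iota q) (pushforward iota q v).
Proof.
move=> dq /(tangentP Mpsi dq)[u ->]; rewrite pushforward_tvec //.
by apply: tangent_tvec => //; exact: slice_domE.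
Qed.

Lemma pushforward_linear q (k : R) v w : cdom psi q -> tangent q v -> tangent q w ->
  pushforward iota q (k *: v + w) = k *: pushforward iota q v + pushforward iota q w.
Proof.
move=> dq /(tangentP Mpsi dq)[u ->] /(tangentP Mpsi dq)[u' ->].
rewrite -tvec_linear // !pushforward_tvec // mulmxDl -scalemxAl tvec_linear //.
exact: slice_domE.
Qed.

Lemma pushforwardB q v w : cdom psi q -> tangent q v -> tangent q w ->
  pushforward iota q (v - w) = pushforward iota q v - pushforward iota q w.
Proof.
move=> dq tv tw; rewrite -scaleN1r addrC pushforward_linear // scaleN1r.
by rewrite addrC.
Qed.

Lemma pushforward_eq0 q v : cdom psi q -> tangent q v -> pushforward iota q v = 0 -> v = 0.
Proof.
move=> dq /(tangentP Mpsi dq)[u ->]; rewrite pushforward_tvec // => E.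
have dp := slice_domE dq.
have /tvec_inj : tvec phi (iota q) (u *m pid_mx m) = tvec phi (iota q) 0.
  by rewrite tvec0.
move=> /(_ Mphi dp) u0; rewrite -(pid_mx_padK u le_mn) u0 mul0mx.
exact: tvec0.
Qed.

(** The points over [U] for the projection that forgets the normal coordinates.
    It depends on [U] only, so that two fields extend to a common open set. *)
Definition extension_dom (U : set S) : set N :=
  cdom phi `&` cmap phi @^-1` ((fun y => y *m pid_mx m) @^-1` (cmap psi @` (cdom psi `&` U))).

(** [X] continued with coordinates that are constant in the normal directions. *)
Definition extension (X : vfield S) : vfield N := fun p =>
  tvec phi p (coords psi (X (cinv psi (cmap phi p *m pid_mx m))) *m pid_mx m).

Lemma extensionP U X : open U -> field_on U X ->
  [/\ open (extension_dom U), field_on (extension_dom U) (extension X),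
      iota @` (cdom psi `&` U) `<=` extension_dom U &
      forall q, (cdom psi `&` U) q -> extension X (iota q) = pushforward iota q (X q)].
Proof.
move=> Uo FX.
have oU : open (cmap psi @` (cdom psi `&` U)) by exact: chart_image_open.
have Vo : open (extension_dom U).
  apply: chart_preimage_open; apply: open_comp => // y _; exact: mulmxr_continuous.
have un q : cdom psi q -> cmap phi (iota q) *m pid_mx m = cmap psi q.
  by move=> dq; rewrite (slice_map Hs dq) pid_mx_padK.
split=> //.
- have Vphi : extension_dom U `<=` cdom phi by move=> p [].
  apply: field_of_coords => // j.
  apply: (smooth_on_of_chart Vo Vphi Mphi).
  have oV : open (cmap phi @` extension_dom U).
    by rewrite -(setIidr Vphi); exact: chart_image_open.
  pose G (y : 'rV[R]_m) := coords psi (X (cinv psi y)) *m (pid_mx m : 'M[R]_(m, n)).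
  apply: (@Cinfty_eq _ _ _ _ ((fun y => G y 0 j) \o (fun y => y *m pid_mx m))) => //.
    by move=> _ [p [dp _] <-] /=; rewrite cmapK.
  apply: (Cinfty_comp_scalar (O := cmap psi @` (cdom psi `&` U))) => //.
  + by move=> _ [p [dp Vp] <-].
  + by move=> k; exact: Ck_mulmxr.
  + move=> k; apply: Ck_coord => //.
    apply: (@Ck_comp _ _ _ _ _ _ setT (fun y => coords psi (X (cinv psi y)))
       (fun y => y *m pid_mx m)) => //; [exact: openT| |by apply: Ck_mulmxr; exact: openT].
    apply: Ck_row => // i.
    have oW : open (cdom psi `&` U) by apply: openI => //; exact: cdom_open.
    have FXW : field_on (cdom psi `&` U) X by apply: field_on_sub FX => q [].
    have sX : smooth_on (cdom psi `&` U) (fun q => X q (coord_fun psi i)).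
      by apply: field_on_coord => // q [].
    have := smooth_on_chart oW Mpsi sX k.
    rewrite setIA setIid; apply: Ck_eq => // y _ /=.
    by rewrite mxE.
- move=> _ [q [dq Uq] <-]; split; first exact: slice_domE.
  by rewrite /= un //; exists q.
- move=> q [dq Uq]; rewrite /extension un // cmapK //.
  rewrite -pushforward_tvec // (coordsK Mpsi dq) //.
  by have [tX _] := FX; exact: tX.
Qed.

End Slice.

(** * Metrics and orthogonal projection *)

Section Metric.
Context {R : realType} {n : nat} {M : manifold R n}.
Variable g : M -> oper M -> oper M -> R.
Hypothesis gP : is_metric g.
Implicit Types (p : M) (a b c : oper M).

Lemma metricB p a b c : tangent p a -> tangent p b -> tangent p c ->
  g p (a - b) c = g p a c - g p b c.
Proof.
move=> ta tb tc; rewrite -scaleN1r addrC (metric_linear gP) // mulN1r.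
by rewrite addrC.
Qed.

Lemma metric0 p c : tangent p c -> g p 0 c = 0.
Proof. by move=> tc; rewrite -{1}(subrr c) metricB // subrr. Qed.

Lemma metricZ p (k : R) a c : tangent p a -> tangent p c -> g p (k *: a) c = k * g p a c.
Proof.
move=> ta tc; rewrite -[k *: a]addr0 (metric_linear gP) //; last exact: tangent0.
by rewrite metric0 // addr0.
Qed.

Lemma metric_sum p (I : Type) (s : seq I) (F : I -> oper M) c :
  (forall i, tangent p (F i)) -> tangent p c ->
  g p (\sum_(i <- s) F i) c = \sum_(i <- s) g p (F i) c.
Proof.
move=> tF tc; elim: s => [|i s IH]; first by rewrite !big_nil metric0.
rewrite !big_cons -[F i]scale1r (metric_linear gP) //; last exact: tangent_sum.
by rewrite mul1r scale1r IH.
Qed.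

Lemma metric_eq0 p a : tangent p a -> g p a a = 0 -> a = 0.
Proof.
move=> ta g0; apply/eqP/negPn/negP => /eqP a0.
by have := metric_pos gP ta a0; rewrite g0 ltxx.
Qed.

(** The Gram matrix of a free family is invertible by positivity; the
    coefficients of the projection solve the corresponding linear system. *)
Lemma orthogonal_projection p m (e : 'I_m -> oper M) w :
  (forall i, tangent p (e i)) -> tangent p w ->
  (forall x : 'rV[R]_m, \sum_i x 0 i *: e i = 0 -> x = 0) ->
  exists x : 'rV[R]_m, forall j, g p (w - \sum_i x 0 i *: e i) (e j) = 0.
Proof.
move=> te tw free_e.
have tse (x : 'rV[R]_m) : tangent p (\sum_i x 0 i *: e i).
  by apply: tangent_sum => i; exact: tangentZ.
pose G : 'M[R]_m := \matrix_(i, j) g p (e i) (e j).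
have GE (x : 'rV[R]_m) j : (x *m G) 0 j = g p (\sum_i x 0 i *: e i) (e j).
  rewrite mxE metric_sum //; last by move=> i; exact: tangentZ.
  by apply: eq_bigr => i _; rewrite mxE metricZ.
have uG : G \in unitmx.
  rewrite -row_free_unit; apply/inj_row_free => x xG.
  apply: free_e; apply: (@metric_eq0 p) => //.
  rewrite metric_sum //; last by move=> i; exact: tangentZ.
  apply: big1 => i _; rewrite metricZ // (metric_sym gP) //.
  by rewrite -GE xG mxE mulr0.
exists (\row_j g p w (e j) *m invmx G) => j.
by rewrite metricB // -GE mulmxKV // mxE subrr.
Qed.

End Metric.

(** * Torsion of the projected connection *)

Section Gauss.
Context {R : realType} {m n : nat}.
Hypothesis le_mn : (m <= n)%N.
Variables (S : manifold R m) (N : riemann_cartan R n) (iota : S -> N).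
Variables (psi : chart R m S) (phi : chart R n N).
Hypothesis Hs : slice_chart iota psi phi.
Let Mpsi := slice_source Hs.
Let Mphi := slice_target Hs.
Local Notation g := (@rc_metric R n N).
Local Notation D := (@rc_conn R n N).
Let gP : is_metric g := rc_metricP N.
Let DP : is_connection D := rc_connP N.
Implicit Types (X Y : vfield S) (q : S) (U : set S) (V : set N).

(** The covariant derivative of extensions of [X] and [Y], written with [X] and
    [Y] alone: it is the expression of [conn_frame] in which the ambient
    coordinate functions are pulled back to [S]. *)
Definition ambient_conn X Y q : oper N :=
  \sum_j (X q (fun r => Y r (coord_fun phi j \o iota)) : R) *: frame phi j (iota q) +
  \sum_j \sum_i ((X q (coord_fun phi i \o iota) : R) * (Y q (coord_fun phi j \o iota) : R)) *:
       D (frame phi i) (frame phi j) (iota q).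

(** Any two extensions give the same covariant derivative along [S]: at
    [iota q] the expression of [conn_frame] differentiates coordinates of [Y']
    only in a direction tangent to [S], where they are those of [Y]. *)
Lemma conn_extends U V X Y (X' Y' : vfield N) q : open U -> U q -> open V -> cdom psi q ->
  extends iota U X V X' -> extends iota U Y V Y' -> D X' Y' (iota q) = ambient_conn X Y q.
Proof.
move=> Uo Uq Vo dq [FX FX' UV EX] [FY FY' _ EY].
have Vq : V (iota q) by apply: UV; exists q.
have dp := slice_domE Hs dq.
have tX : tangent q (X q) by have [tX _] := FX; exact: tX.
pose W := V `&` cdom phi.
have Wo : open W by apply: openI => //; exact: cdom_open.
have sY' j : smooth_at (iota q) (fun p => Y' p (coord_fun phi j)).
  apply: (@smooth_at_on _ _ _ W) => //; apply: field_on_coord => //.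
    by move=> p [].
  by apply: field_on_sub FY' => p [].
have EX' j : X' (iota q) (coord_fun phi j) = X q (coord_fun phi j \o iota).
  by rewrite EX // pushforwardE //; exact: coord_fun_smooth_at.
have EY' r j : U r -> cdom psi r ->
    Y' (iota r) (coord_fun phi j) = Y r (coord_fun phi j \o iota).
  move=> Ur dr; rewrite EY // pushforwardE //.
  by apply: coord_fun_smooth_at => //; exact: (slice_domE Hs).
rewrite (conn_frame DP Mphi dp Vo Vq FX' FY') /ambient_conn; congr (_ + _).
  apply: eq_bigr => j _; congr (_ *: _).
  rewrite EX // pushforwardE //.
  apply: (tangent_near (U := U `&` cdom psi) tX) => //.
    by apply: openI => //; exact: cdom_open.
  by move=> r [Ur dr]; rewrite /= EY'.
by apply: eq_bigr => j _; apply: eq_bigr => i _; rewrite EX' EY'.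
Qed.

Lemma tangent_ambient_conn X Y q : cdom psi q ->
  tangent (iota q) (ambient_conn X Y q).
Proof.
move=> dq; have dp := slice_domE Hs dq.
apply: tangentD; apply: tangent_sum => j.
  by apply: tangentZ; exact: tangent_tvec.
apply: tangent_sum => i; apply: tangentZ.
have FE k := frame_field k Mphi.
by have [tD _] := conn_field DP (cdom_open phi) (FE i) (FE j); exact: tD.
Qed.

Lemma tangential_part_exists q w : cdom psi q -> tangent (iota q) w ->
  exists v, tangential_part iota q w v.
Proof.
move=> dq tw; have dp := slice_domE Hs dq.
pose e i := tvec phi (iota q) ('e_i *m (pid_mx m : 'M[R]_(m, n))).
have te i : tangent (iota q) (e i) by exact: tangent_tvec.
have esum (x : 'rV[R]_m) : \sum_i x 0 i *: e i = pushforward iota q (tvec psi q x).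
  rewrite (pushforward_tvec Hs) // {2}(row_sum_delta x) mulmx_suml tvec_sum //.
  by apply: eq_bigr => i _; rewrite -scalemxAl tvecZ.
have [x|x Hx] := orthogonal_projection gP te tw.
  rewrite esum => /(pushforward_eq0 le_mn Hs dq (tangent_tvec _ Mpsi dq)).
  by rewrite -(tvec0 Mpsi dq) => /tvec_inj; exact.
exists (tvec psi q x); split; first exact: tangent_tvec.
move=> _ /(tangentP Mpsi dq)[y ->]; rewrite -!esum.
have tws : tangent (iota q) (w - \sum_i x 0 i *: e i).
  by apply: tangentB => //; apply: tangent_sum => i; exact: tangentZ.
rewrite (metric_sym gP) //; last by apply: tangent_sum => i; exact: tangentZ.
rewrite (metric_sum gP) //; last by move=> i; exact: tangentZ.
apply: big1 => i _; rewrite (metricZ gP) // (metric_sym gP) //.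
by rewrite Hx mulr0.
Qed.

(** The extensions hidden in [projected_connection] are arbitrary, but by
    [conn_extends] the vector that is projected does not depend on them. *)
Lemma projected_connectionP U X Y q : open U -> U q -> cdom psi q ->
  field_on U X -> field_on U Y ->
  tangential_part iota q (ambient_conn X Y q) (projected_connection iota X Y q).
Proof.
move=> Uo Uq dq FX FY; rewrite /projected_connection; set A := [set v | _].
have : exists v, A v.
  have [v Hv] := tangential_part_exists dq (tangent_ambient_conn X Y dq).
  have oW : open (cdom psi `&` U) by apply: openI => //; exact: cdom_open.
  have [oV FX' WV EX] := extensionP le_mn Hs Uo FX.
  have [_ FY' _ EY] := extensionP le_mn Hs Uo FY.
  have HX : extends iota (cdom psi `&` U) X (extension_dom psi phi U) (extension psi phi X).
    by split=> //; apply: field_on_sub FX => r [].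
  have HY : extends iota (cdom psi `&` U) Y (extension_dom psi phi U) (extension psi phi Y).
    by split=> //; apply: field_on_sub FY => r [].
  exists v, (cdom psi `&` U), (extension_dom psi phi U).
  exists (extension psi phi X), (extension psi phi Y).
  by split=> //; rewrite (conn_extends oW _ oV dq HX HY).
move=> /(xgetPex 0)[U' [V' [X' [Y' [[U'o U'q] V'o HX HY]]]]].
by rewrite (conn_extends U'o U'q V'o dq HX HY).
Qed.

(** Push-forward is compatible with brackets, and [ambient_conn] differs from
    its transpose by a bracket and the torsion of the ambient connection. *)
Lemma ambient_torsion U X Y q : open U -> U q -> cdom psi q ->
  field_on U X -> field_on U Y ->
  ambient_conn X Y q - ambient_conn Y X q - pushforward iota q (bracket X Y q) =
  torsion_tensor D phi (iota q) (pushforward iota q (X q)) (pushforward iota q (Y q)).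
Proof.
move=> Uo Uq dq FX FY; have dp := slice_domE Hs dq.
have tb := tangent_bracket Uo Uq FX FY.
rewrite (tangent_delta Mphi dp (pushforward_tangent Hs dq tb)).
have sx j : smooth_at (iota q) (coord_fun phi j) by exact: coord_fun_smooth_at.
under [X in _ - X]eq_bigr => j _.
  rewrite pushforwardE // /bracket germ_opE; last exact: (smooth_at_pullback Hs).
  rewrite scalerBl; over.
rewrite sumrB /torsion_tensor.
under [RHS]eq_bigr => i _ do under eq_bigr => j _ do rewrite !pushforwardE //.
rewrite -(antisym_split (fun i => X q (coord_fun phi i \o iota))
  (fun i => Y q (coord_fun phi i \o iota))
  (fun i j => D (frame phi i) (frame phi j) (iota q))).
exact: addr_cancel_difference.
Qed.

(** The torsion of a submanifold is the tangential part of the ambient torsion. *)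
Lemma Gauss_torsion U X Y q : open U -> U q -> cdom psi q ->
  field_on U X -> field_on U Y ->
  tangent q (torsion (projected_connection iota) X Y q) /\
  forall z, tangent q z ->
    g (iota q) (pushforward iota q (torsion (projected_connection iota) X Y q))
      (pushforward iota q z) =
    g (iota q) (torsion_tensor D phi (iota q) (pushforward iota q (X q))
        (pushforward iota q (Y q))) (pushforward iota q z).
Proof.
move=> Uo Uq dq FX FY; have dp := slice_domE Hs dq.
have tb := tangent_bracket Uo Uq FX FY.
have [t1 H1] := projected_connectionP Uo Uq dq FX FY.
have [t2 H2] := projected_connectionP Uo Uq dq FY FX.
have t12 := tangentB t1 t2.
split; first by rewrite /torsion; exact: tangentB.
move=> z tz; rewrite -(ambient_torsion Uo Uq dq FX FY) /torsion.
have pT v : tangent q v -> tangent (iota q) (pushforward iota q v).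
  exact: (pushforward_tangent Hs dq).
have tA := tangent_ambient_conn X Y dq.
have tB := tangent_ambient_conn Y X dq.
rewrite !(pushforwardB Hs) // ![g _ (_ - _ - _) _](metricB gP) //; try exact: pT;
  try (by apply: tangentB; exact: pT); try exact: tangentB.
congr (_ - _).
have := H1 z tz; have := H2 z tz.
rewrite !(metricB gP) //; try exact: pT.
by move=> /eqP; rewrite subr_eq0 => /eqP -> /eqP; rewrite subr_eq0 => /eqP ->.
Qed.

(** What both directions of the theorem use: the torsion of a submanifold
    vanishes at [q] iff the trilinear form [<Z, T(X, Y)>] of the ambient
    manifold vanishes on the three vectors tangent to the submanifold. *)
Lemma torsion_projected_eq0 U X Y q : open U -> U q -> cdom psi q ->
  field_on U X -> field_on U Y ->
  torsion (projected_connection iota) X Y q = 0 <->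
  forall z, tangent q z ->
    g (iota q) (torsion_tensor D phi (iota q) (pushforward iota q (X q))
        (pushforward iota q (Y q))) (pushforward iota q z) = 0.
Proof.
move=> Uo Uq dq FX FY; have dp := slice_domE Hs dq.
have [tt Ht] := Gauss_torsion Uo Uq dq FX FY; split=> [t0 z tz|H].
  rewrite -Ht // t0.
  have -> : pushforward iota q 0 = 0.
    rewrite -[in LHS](subrr (0 : oper S)) (pushforwardB Hs) ?subrr //; exact: tangent0.
  by apply: (metric0 gP); exact: (pushforward_tangent Hs).
apply: (pushforward_eq0 le_mn Hs dq tt).
apply: (metric_eq0 gP (pushforward_tangent Hs dq tt)).
by rewrite Ht // H.
Qed.

End Gauss.

(** * Affine changes of charts *)

Section AffineChart.
Context {R : realType} {n : nat} {M : manifold R n}.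
Variables (phi : chart R n M) (A : 'M[R]_n) (b : 'rV[R]_n).
Hypothesis uA : A \in unitmx.

Let aff (y : 'rV[R]_n) := y *m A + b.
Let affi (y : 'rV[R]_n) := y *m invmx A + - (b *m invmx A).

Let affK : cancel aff affi.
Proof. by move=> y; rewrite /aff /affi mulmxDl mulmxK // addrK. Qed.

Let affiK : cancel affi aff.
Proof. by move=> y; rewrite /aff /affi mulmxDl mulNmx !mulmxKV // subrK. Qed.

Let aff_image (O : set 'rV[R]_n) : aff @` O = affi @^-1` O.
Proof.
apply/seteqP; split=> [_ [y Oy <-]|y Oy]; first by rewrite /= affK.
by exists (affi y) => //; rewrite affiK.
Qed.

Let aff_open O : open O -> open (aff @` O).
Proof.
by move=> Oo; rewrite aff_image; apply: open_comp => // y _; exact: affine_continuous.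
Qed.

Let image_aff (U : set M) : (aff \o cmap phi) @` U = aff @` (cmap phi @` U).
Proof. by rewrite image_comp. Qed.

Fact affine_img_open : open ((aff \o cmap phi) @` cdom phi).
Proof. by rewrite image_aff; apply: aff_open; exact: cimg_open. Qed.

Fact affine_map_cont p : cdom phi p -> {for p, continuous (aff \o cmap phi)}.
Proof.
by move=> dp; apply: continuous_comp; [exact: cmap_cont|exact: affine_continuous].
Qed.

Fact affine_inv_cont x : ((aff \o cmap phi) @` cdom phi) x ->
  {for x, continuous (cinv phi \o affi)}.
Proof.
rewrite image_aff aff_image => ix; apply: continuous_comp; first exact: affine_continuous.
exact: cinv_cont.
Qed.

Fact affine_mapK p : cdom phi p -> (cinv phi \o affi) ((aff \o cmap phi) p) = p.
Proof. by move=> dp; rewrite /= affK cmapK. Qed.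

Definition affine_chart : chart R n M :=
  Chart (cdom_open phi) affine_img_open affine_map_cont affine_inv_cont affine_mapK.

Lemma affine_chart_maximal : maximal_atlas phi -> maximal_atlas affine_chart.
Proof.
move=> Mphi psi Apsi; have [c1 c2] := Mphi psi Apsi.
have op : open (cmap phi @` (cdom phi `&` cdom psi)).
  by apply: chart_image_open; exact: cdom_open.
split.
  rewrite /= image_aff.
  apply: (@Cinfty_comp _ _ _ _ _ _ affi (cmap psi \o cinv phi) _ op) => //.
  - exact: aff_open.
  - by rewrite aff_image.
  - by apply: Cinfty_affine; exact: aff_open.
have oq : open (cmap psi @` (cdom phi `&` cdom psi)).
  by rewrite setIC; apply: chart_image_open; exact: cdom_open.
apply: (@Cinfty_comp _ _ _ _ _ setT (cmap phi \o cinv psi) aff oq openT) => //.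
by apply: Cinfty_affine; exact: openT.
Qed.

Lemma tvec_affine p u : maximal_atlas phi -> cdom phi p ->
  tvec phi p u = tvec affine_chart p (u *m A).
Proof.
move=> Mphi dp; rewrite (tvec_change u Mphi (affine_chart_maximal Mphi) dp dp).
congr (tvec _ _ _); rewrite (near_eq_derive (g := aff)); last first.
  have := near_chart openT dp I.
  by apply: filterS => _ [q [dq _] <-] /=; rewrite cmapK.
rewrite /aff; have dA := mulmxr_differentiable A (cmap phi p).
rewrite (@deriveD _ _ _ (fun y => y *m A) (cst b)).
- by rewrite derive_mulmxr derive_cst addr0.
- exact: diff_derivable.
- exact: derivable_cst.
Qed.

End AffineChart.

(** * Coordinate slices as embedded hypersurfaces *)

Section CoordinateSlice.
Context {R : realType} {m : nat} {M : manifold R m.+1}.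
Variables (phi : chart R m.+1 M) (p0 : M).
Hypothesis Mphi : maximal_atlas phi.

(** The level set of the last coordinate is a hypersurface for its subset
    topology: Hausdorff separation and second countability are inherited from
    [M], and the remaining coordinates form a single global chart. *)
Definition slice_set : set M := [set p | cdom phi p /\ cmap phi p 0 ord_max = 0].
Hypothesis p0_slice : slice_set p0.

Let S : topologicalType := set_type slice_set.

Lemma slice_val_continuous : continuous (\val : S -> M).
Proof. exact: initial_continuous. Qed.

Lemma slice_nbhsP (s : S) V : nbhs s V -> exists W, [/\ open W, W (\val s) &
  forall s' : S, W (\val s') -> V s'].
Proof. by case=> _ [[W Wo <-] Ws WV]; exists W. Qed.

Lemma slice_hausdorff : hausdorff_space S.
Proof.
move=> p q cpq; apply: val_inj; apply: mfd_hausdorff => A B nA nB.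
have nA' : nbhs p (\val @^-1` A) by exact: slice_val_continuous.
have nB' : nbhs q (\val @^-1` B) by exact: slice_val_continuous.
by have [s [As Bs]] := cpq _ _ nA' nB'; exists (\val s).
Qed.

Lemma slice_second_countable : @second_countable S.
Proof.
have [B cB [Bo HB]] := mfd_second_countable M.
exists [set (\val : S -> M) @^-1` U | U in B].
  by apply: sub_countable cB; exact: card_image_le.
split=> [_ [U BU <-]|s V /slice_nbhsP[W [Wo Ws WV]]].
  apply: open_comp; last exact: Bo.
  by move=> *; exact: slice_val_continuous.
have [|U [BU Us] UW] := HB (\val s) W; first by apply: open_nbhs_nbhs.
by exists (\val @^-1` U); [split=> //; exists U|move=> s' Us'; apply: WV; exact: UW].
Qed.

Let base_point : S := Sub p0 (mem_set p0_slice).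

Definition slice_cmap (s : S) : 'rV[R]_m := cmap phi (\val s) *m pid_mx m.
(** Points outside the image of the slice are sent to the base point, as an
    inverse chart must be a total map. *)
Definition slice_cinv (y : 'rV[R]_m) : S :=
  insubd base_point (cinv phi (y *m pid_mx m)).

Let sliceP (s : S) : slice_set (\val s).
Proof. by have /set_mem := valP s. Qed.

Lemma slice_unpadK (x : 'rV[R]_m.+1) : x 0 ord_max = 0 ->
  (x *m (pid_mx m : 'M[R]_(m.+1, m))) *m (pid_mx m : 'M[R]_(m, m.+1)) = x.
Proof.
move=> x0; have -> : x = (\row_i x 0 (widen_ord (leqnSn m) i)) *m pid_mx m.
  apply: pid_mx_padP => j; split=> [i ij|mj].
    by rewrite mxE; congr (x 0 _); apply: val_inj.
  rewrite -x0; congr (x 0 _); apply: val_inj => /=.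
  by apply/eqP; rewrite eqn_leq mj -ltnS ltn_ord.
by rewrite pid_mx_padK.
Qed.

Lemma slice_pad_val s : slice_cmap s *m pid_mx m = cmap phi (\val s).
Proof. by have [_] := sliceP s; exact: slice_unpadK. Qed.

Lemma slice_imageE : slice_cmap @` setT =
  (fun y => y *m pid_mx m) @^-1` (cmap phi @` cdom phi).
Proof.
apply/seteqP; split=> [_ [s _ <-]|y [p dp py]].
  by rewrite /= slice_pad_val; exists (\val s) => //; have [] := sliceP s.
have Sp : slice_set p by split=> //; rewrite py pid_mx_pad0.
exists (Sub p (mem_set Sp)) => //.
by rewrite /slice_cmap SubK py pid_mx_padK.
Qed.

Fact slice_img_open : open (slice_cmap @` setT).
Proof.
rewrite slice_imageE; apply: open_comp; last exact: cimg_open.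
by move=> y _; exact: mulmxr_continuous.
Qed.

Fact slice_cmap_cont s : setT s -> {for s, continuous slice_cmap}.
Proof.
move=> _.
suff : {for s, continuous ((fun y => y *m (pid_mx m : 'M[R]_(m.+1, m))) \o
    (cmap phi \o (\val : S -> M)))} by [].
apply: continuous_comp; last exact: mulmxr_continuous.
apply: continuous_comp; first exact: slice_val_continuous.
by apply: cmap_cont; have [] := sliceP s.
Qed.

Lemma slice_cinvE y : (slice_cmap @` setT) y ->
  \val (slice_cinv y) = cinv phi (y *m pid_mx m).
Proof.
move=> [s _ <-]; rewrite slice_pad_val cmapK; last by have [] := sliceP s.
by rewrite /slice_cinv slice_pad_val cmapK ?valKd //; have [] := sliceP s.
Qed.

Fact slice_cinv_cont y : (slice_cmap @` setT) y -> {for y, continuous slice_cinv}.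
Proof.
move=> iy V /slice_nbhsP[W [Wo Wy WV]].
have nW : \forall z \near y, W (cinv phi (z *m pid_mx m)).
  have cy : {for y, continuous (cinv phi \o (fun z => z *m pid_mx m))}.
    apply: continuous_comp; first exact: mulmxr_continuous.
    by apply: cinv_cont; rewrite slice_imageE in iy.
  by apply: cy; apply: open_nbhs_nbhs; split=> //; rewrite slice_cinvE in Wy.
have ni : \forall z \near y, (slice_cmap @` setT) z.
  by apply: open_nbhs_nbhs; split=> //; exact: slice_img_open.
by apply: filterS2 nW ni => z Wz iz; apply: WV; rewrite slice_cinvE.
Qed.

Fact slice_cmapK s : setT s -> slice_cinv (slice_cmap s) = s.
Proof.
by move=> _; rewrite /slice_cinv slice_pad_val cmapK ?valKd //; have [] := sliceP s.
Qed.

Definition slice_global_chart : chart R m S :=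
  Chart openT slice_img_open slice_cmap_cont slice_cinv_cont slice_cmapK.

Fact slice_cover (s : S) :
  exists2 psi, [set slice_global_chart] psi & cdom psi s.
Proof. by exists slice_global_chart. Qed.

Fact slice_compat psi psi' : [set slice_global_chart] psi ->
  [set slice_global_chart] psi' -> chart_compat psi psi'.
Proof.
move=> -> ->.
suff : Cinfty (slice_cmap @` (setT `&` setT)) (slice_cmap \o slice_cinv) by [].
rewrite setTI => k; apply: (@Ck_eq _ _ _ _ _ id); first exact: slice_img_open.
  by move=> _ [s _ <-] /=; rewrite slice_cmapK.
exact: Ck_id.
Qed.

Definition slice_manifold : manifold R m :=
  Manifold slice_hausdorff slice_second_countable slice_cover slice_compat.

Lemma slice_manifoldP :
  exists (S' : manifold R m) (iota : S' -> M) (psi : chart R m S') (q0 : S'),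
  [/\ embedding iota, slice_chart iota psi phi, cdom psi q0 & iota q0 = p0].
Proof.
pose psi : chart R m slice_manifold := slice_global_chart.
have Mpsi : maximal_atlas psi by exact: atlas_maximal.
have dom : cdom psi = (\val : slice_manifold -> M) @^-1` cdom phi.
  by apply/seteqP; split=> // s _; have [] := sliceP s.
exists slice_manifold, \val, psi, base_point; split=> //.
  split=> [|q]; first exact: val_inj.
  exists psi, phi; split=> //; split=> [s _ j|p dp pj].
    by rewrite -slice_pad_val; split=> [i ij|mj]; [exact: pid_mx_padE|exact: pid_mx_pad0].
  have Sp : slice_set p by split=> //; exact: pj.
  by exists (Sub p (mem_set Sp)).
by split=> // s _; rewrite slice_pad_val.
Qed.

End CoordinateSlice.

(** * Algebra of the torsion tensor *)

Section TorsionTensor.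
Context {R : realType} {n : nat} {M : manifold R n}.
Variable D : vfield M -> vfield M -> vfield M.
Hypothesis HD : is_connection D.
Implicit Types (phi : chart R n M) (p : M) (a b c : oper M).

Lemma torsion_tensor_linearr phi p (k : R) a b b' :
  torsion_tensor D phi p a (k *: b + b') =
  k *: torsion_tensor D phi p a b + torsion_tensor D phi p a b'.
Proof.
rewrite !(torsion_tensor_antisym D phi p a) torsion_tensor_linearl.
by rewrite opprD scalerN.
Qed.

Lemma torsion_tensor0l phi p b : torsion_tensor D phi p 0 b = 0.
Proof.
apply: big1 => i _; apply: big1 => j _.
suff -> : ((0 : oper M) (coord_fun phi i) : R) = 0 by rewrite mul0r scale0r.
by [].
Qed.

Lemma torsion_tensor0r phi p a : torsion_tensor D phi p a 0 = 0.
Proof. by rewrite torsion_tensor_antisym torsion_tensor0l oppr0. Qed.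

Lemma torsion_tensor_sum phi p k (x y : 'rV[R]_k) (e : 'I_k -> oper M) :
  torsion_tensor D phi p (\sum_i x 0 i *: e i) (\sum_j y 0 j *: e j) =
  \sum_i \sum_j (x 0 i * y 0 j) *: torsion_tensor D phi p (e i) (e j).
Proof.
have suml b (s : seq 'I_k) : torsion_tensor D phi p (\sum_(i <- s) x 0 i *: e i) b =
    \sum_(i <- s) x 0 i *: torsion_tensor D phi p (e i) b.
  elim: s => [|i s IH]; first by rewrite !big_nil torsion_tensor0l.
  by rewrite !big_cons torsion_tensor_linearl IH.
have sumr a (s : seq 'I_k) : torsion_tensor D phi p a (\sum_(i <- s) y 0 i *: e i) =
    \sum_(i <- s) y 0 i *: torsion_tensor D phi p a (e i).
  elim: s => [|i s IH]; first by rewrite !big_nil torsion_tensor0r.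
  by rewrite !big_cons torsion_tensor_linearr IH.
rewrite suml; apply: eq_bigr => i _; rewrite sumr scaler_sumr.
by apply: eq_bigr => j _; rewrite scalerA.
Qed.

Lemma const_field phi (u : 'rV[R]_n) : maximal_atlas phi ->
  field_on (cdom phi) (fun q => tvec phi q u).
Proof. by move=> Mphi; apply: field_of_coords => // j; exact: smooth_on_cst. Qed.

Lemma torsion_tensor_const phi p u v : maximal_atlas phi -> cdom phi p ->
  torsion_tensor D phi p (tvec phi p u) (tvec phi p v) =
  torsion D (fun q => tvec phi q u) (fun q => tvec phi q v) p.
Proof.
move=> Mphi dp; rewrite (torsion_tensorE HD Mphi dp (cdom_open phi) dp) //;
  exact: const_field.
Qed.

(** Every tangent vector is a value of a field with constant coordinates, so
    conditions on fields are conditions on the tensor at each point. *)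
Lemma torsion_free_tensor phi p a b : torsion_free D -> maximal_atlas phi -> cdom phi p ->
  tangent p a -> tangent p b -> torsion_tensor D phi p a b = 0.
Proof.
move=> tf Mphi dp /(tangentP Mphi dp)[u ->] /(tangentP Mphi dp)[v ->].
rewrite torsion_tensor_const //.
by apply: (tf (cdom phi)) => //; [exact: cdom_open|exact: const_field|exact: const_field].
Qed.

Lemma totally_skew_tensor g phi p a b c : torsion_totally_skew g D ->
  maximal_atlas phi -> cdom phi p -> tangent p a -> tangent p b -> tangent p c ->
  [\/ a = b, b = c | a = c] -> g p a (torsion_tensor D phi p b c) = 0.
Proof.
move=> sk Mphi dp /(tangentP Mphi dp)[u ->] /(tangentP Mphi dp)[v ->].
move=> /(tangentP Mphi dp)[w ->] E; rewrite torsion_tensor_const //.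
have F z := const_field z Mphi.
exact: (sk _ (fun q => tvec phi q u) _ _ (cdom_open phi) (F u) (F v) (F w)).
Qed.

Lemma tangent_torsion U X Y p : open U -> U p -> field_on U X -> field_on U Y ->
  tangent p (torsion D X Y p).
Proof.
move=> Uo Up FX FY; have [phi Mphi dp] := maximal_chart_at p.
by rewrite (torsion_tensorE HD Mphi dp Uo Up FX FY); exact: tangent_torsion_tensor.
Qed.

End TorsionTensor.

(** * Torsion of hypersurfaces *)

Section Hypersurfaces.
Context {R : realType}.

Lemma pushforward_sum m n (S : manifold R m) (N : manifold R n) (iota : S -> N) psi phi q v :
  slice_chart iota psi phi -> cdom psi q -> tangent q v ->
  exists x : 'rV[R]_m, pushforward iota q v =
    \sum_i x 0 i *: pushforward iota q (tvec psi q 'e_i).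
Proof.
move=> Hs dq /(tangentP (slice_source Hs) dq)[x ->]; exists x.
have Mphi := slice_target Hs; have dp := slice_domE Hs dq.
rewrite (pushforward_tvec Hs) // {1}(row_sum_delta x) mulmx_suml tvec_sum //.
by apply: eq_bigr => i _; rewrite (pushforward_tvec Hs) // -scalemxAl tvecZ.
Qed.

(** Gaussian elimination writes [B] as [L *m pid_mx r *m U] with [r] its rank, so
    multiplication by the inverse of [U] clears the last coordinate of every
    vector in the row space of a rank-deficient [B]. This is the linear change
    of coordinates that makes a prescribed hyperplane a coordinate one. *)
Lemma mulmx_last_eq0 m k (B : 'M[R]_(k, m.+1)) (x : 'rV[R]_m.+1) :
  (\rank B < m.+1)%N -> (x <= B)%MS -> (x *m invmx (row_ebase B)) 0 ord_max = 0.
Proof.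
move=> rB /submxP[d ->].
have E : B *m invmx (row_ebase B) = col_ebase B *m pid_mx (\rank B).
  by rewrite -[X in X *m _](mulmx_ebase B) mulmxK ?row_ebase_unit.
rewrite -mulmxA E mulmxA mxE big1 // => j _.
rewrite [pid_mx _ _ _]mxE; case: eqP => [->|]; last by rewrite mulr0.
by rewrite /= ltnNge -ltnS rB mulr0.
Qed.

(** A hypersurface through [p] whose tangent space contains [X p], [Y p] and [c]
    exists as soon as the span of these vectors is not everything: it is a
    coordinate slice of an affine modification of [phi]. Its vanishing torsion
    annihilates the trilinear form on the three vectors. The matrix [B] lists
    spanning vectors, so that repeated vectors can be counted once. *)
Lemma hyperplane_torsion m (N : riemann_cartan R m.+1) U X Y p c k
    (B : 'M[R]_(k, m.+1)) phi :
  (forall (S : manifold R m) (iota : S -> N), embedding iota ->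
     torsion_free (projected_connection iota)) ->
  open U -> U p -> field_on U X -> field_on U Y -> tangent p c ->
  maximal_atlas phi -> cdom phi p -> (\rank B < m.+1)%N ->
  (coords phi (X p) <= B)%MS -> (coords phi (Y p) <= B)%MS -> (coords phi c <= B)%MS ->
  rc_metric p (torsion (@rc_conn R m.+1 N) X Y p) c = 0.
Proof.
move=> Hall Uo Up FX FY tc Mphi dp rB XB YB cB.
have DP := rc_connP N.
have uA : invmx (row_ebase B) \in unitmx by rewrite unitmx_inv row_ebase_unit.
set A := invmx _ in uA.
pose phi' := affine_chart phi (- (cmap phi p *m A)) uA.
have Mphi' : maximal_atlas phi' by exact: affine_chart_maximal.
have p0 : slice_set phi' p by split=> //=; rewrite subrr mxE.
have [S [iota [psi [q [emb Hs dq Eq]]]]] := slice_manifoldP Mphi' p0.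
have lift a : tangent p a -> (coords phi a <= B)%MS ->
    exists x, a = pushforward iota q (tvec psi q x).
  move=> ta aB; exists ((coords phi a *m A) *m pid_mx m).
  rewrite (pushforward_tvec Hs _ dq) slice_unpadK; last exact: mulmx_last_eq0.
  by rewrite Eq -tvec_affine // coordsK.
have [tX _] := FX; have [tY _] := FY.
have [x Ex] := lift _ (tX _ Up) XB; have [y Ey] := lift _ (tY _ Up) YB.
have [z Ez] := lift _ tc cB.
have F u := const_field u (slice_source Hs).
rewrite (torsion_tensorE DP Mphi' dp Uo Up FX FY) Ex Ey Ez -Eq.
have := Hall S iota emb _ _ _ (cdom_open psi) (F x) (F y) q dq.
move/(torsion_projected_eq0 (leqnSn m) Hs (cdom_open psi) dq dq (F x) (F y)).
by apply; apply: tangent_tvec => //; exact: slice_source Hs.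
Qed.

Lemma sub_col_mxl m1 m2 n (A : 'M[R]_(m1, n)) (B : 'M[R]_(m2, n)) : (A <= col_mx A B)%MS.
Proof. by rewrite -addsmxE addsmxSl. Qed.

Lemma sub_col_mxr m1 m2 n (A : 'M[R]_(m1, n)) (B : 'M[R]_(m2, n)) : (B <= col_mx A B)%MS.
Proof. by rewrite -addsmxE addsmxSr. Qed.

Lemma ord2_pigeonhole (i j k : 'I_2) : [\/ k = i, i = j | k = j].
Proof.
case: (eqVneq k i) => [->|ki]; first by constructor 1.
case: (eqVneq i j) => [->|ij]; first by constructor 2.
constructor 3; apply: val_inj; move: ki ij; rewrite -!val_eqE.
by case: i j k => [[|[|//]] ?] [[|[|//]] ?] [[|[|//]] ?].
Qed.

(** The form [<Z, T(X, Y)>] is expanded over a basis of the tangent space of the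
    hypersurface. In dimension at most 1 only the terms [T(e, e) = 0] occur, and
    in dimension 2 two of the three basis vectors in each term agree. *)
Lemma hypersurface_torsion_free n (M : riemann_cartan R n) m (S : manifold R m)
    (iota : S -> M) :
  hypersurface iota ->
  [\/ (n <= 2)%N,
      n = 3%N /\ torsion_totally_skew (@rc_metric R n M) (@rc_conn R n M)
    | (4 <= n)%N /\ torsion_free (@rc_conn R n M)] ->
  torsion_free (projected_connection iota).
Proof.
move=> [mn emb] H U X Y Uo FX FY q Uq.
have le_mn : (m <= n)%N by rewrite -mn.
have DP := rc_connP M; have gP := rc_metricP M.
have [psi [phi [Hs dq]]] := embedding_slice emb q.
have Mphi := slice_target Hs; have Mpsi := slice_source Hs.
have dp := slice_domE Hs dq.
apply/(torsion_projected_eq0 le_mn Hs Uo Uq dq FX FY) => c tc.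
have [tX _] := FX; have [tY _] := FY.
have pT v : tangent q v -> tangent (iota q) (pushforward iota q v).
  exact: (pushforward_tangent Hs dq).
have [x Ex] := pushforward_sum Hs dq (tX _ Uq).
have [y Ey] := pushforward_sum Hs dq (tY _ Uq).
have [z Ez] := pushforward_sum Hs dq tc.
have te i : tangent (iota q) (pushforward iota q (tvec psi q 'e_i)).
  by apply: pT; exact: tangent_tvec.
have tT a b : tangent (iota q) (torsion_tensor (@rc_conn R n M) phi (iota q) a b).
  exact: tangent_torsion_tensor.
case: H => [n2|[n3 sk]|[_ tf]].
- rewrite Ex Ey torsion_tensor_sum (_ : \sum_i _ = 0); first by apply: (metric0 gP); exact: pT.
  apply: big1 => i _; apply: big1 => j _.
  have -> : i = j.
    apply: val_inj => /=; move: (ltn_ord i) (ltn_ord j).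
    have : (m <= 1)%N by rewrite -ltnS mn.
    by case: (m) i j => [[]//|[|//]] i j _; rewrite !ltnS !leqn0 => /eqP -> /eqP ->.
  by rewrite torsion_tensor_alt scaler0.
- rewrite Ex Ey Ez torsion_tensor_sum.
  have tes : tangent (iota q) (\sum_i z 0 i *: pushforward iota q (tvec psi q 'e_i)).
    by apply: tangent_sum => i; exact: tangentZ.
  rewrite (metric_sum gP) //; last first.
    by move=> i; apply: tangent_sum => j; exact: tangentZ.
  apply: big1 => i _; rewrite (metric_sum gP) //; last by move=> j; exact: tangentZ.
  apply: big1 => j _; rewrite (metricZ gP) // (metric_sym gP) //.
  rewrite (metric_sum gP) //; last by move=> k; exact: tangentZ.
  rewrite big1 ?mulr0 // => k _; rewrite (metricZ gP) //.
  rewrite (totally_skew_tensor DP sk) ?mulr0 //.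
  have m2 : m = 2%N by apply: succn_inj; rewrite mn.
  move: (m2) i j k => {}m2; clear -m2; subst m => i j k.
  by case: (ord2_pigeonhole i j k) => ->; [constructor 1|constructor 2|constructor 3].
- rewrite (torsion_free_tensor DP tf) // ?(metric0 gP) //; apply: pT;
    by [exact: tc|exact: tX|exact: tY].
Qed.

End Hypersurfaces.

(* The dimensions below are natural numbers. *)
Local Close Scope ring_scope.

Theorem proposition3p15 (R : realType) (n : nat) (M : riemann_cartan R n) :
  (forall (m : nat) (S : manifold R m) (iota : S -> M),
     hypersurface iota -> torsion_free (projected_connection iota))
  <->
  [\/ (n <= 2)%N,
      n = 3 /\ torsion_totally_skew (@rc_metric R n M) (@rc_conn R n M)
    | (4 <= n)%N /\ torsion_free (@rc_conn R n M)].
Proof.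
split=> [H|H m S iota hyp]; last exact: hypersurface_torsion_free H.
have [n2|n3] := leqP n 2; first by constructor 1.
case: n M n3 H => [//|m] M n3 H.
have Hall (S : manifold R m) (iota : S -> M) : embedding iota ->
    torsion_free (projected_connection iota).
  by move=> emb; apply: H; split.
have DP := rc_connP M; have gP := rc_metricP M.
move: n3; rewrite leq_eqVlt => /orP[/eqP n3|n4].
  constructor 2; split=> // U X Y Z Uo FX FY FZ p Up E.
  have [phi Mphi dp] := maximal_chart_at p.
  have [tX _] := FX; have tT := tangent_torsion DP Uo Up FY FZ.
  rewrite (metric_sym gP) //; last exact: tX.
  (* One of the vectors is repeated, and [v] with [Z p] spans all three. *)
  pose v := if `[< X p = Y p \/ X p = Z p >] then coords phi (Y p) else coords phi (X p).
  pose B := col_mx v (coords phi (Z p)).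
  have rB : (\rank B < m.+1)%N.
    by apply: leq_ltn_trans (rank_leq_row B) _; rewrite -n3.
  suff [XB YB] : (coords phi (X p) <= B)%MS /\ (coords phi (Y p) <= B)%MS.
    apply: (hyperplane_torsion Hall Uo Up FY FZ (tX _ Up) Mphi dp rB) => //.
    exact: sub_col_mxr.
  rewrite /B /v; case: asboolP => [[->|->]|nE]; rewrite ?sub_col_mxl ?sub_col_mxr //.
  by case: E => [XY|->|XZ]; [case: nE; left| |case: nE; right]; rewrite ?sub_col_mxl ?sub_col_mxr.
(* The torsion is tested against itself: three vectors never span a space of
   dimension at least 4. *)
constructor 3; split=> // U X Y Uo FX FY p Up.
have [phi Mphi dp] := maximal_chart_at p.
have tT := tangent_torsion DP Uo Up FX FY.
apply: (metric_eq0 gP tT).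
pose B := col_mx (coords phi (X p)) (col_mx (coords phi (Y p))
  (coords phi (torsion (@rc_conn R m.+1 M) X Y p))).
have rB : (\rank B < m.+1)%N by apply: leq_ltn_trans (rank_leq_row B) _.
apply: (hyperplane_torsion Hall Uo Up FX FY tT Mphi dp rB); first exact: sub_col_mxl.
  exact: submx_trans (sub_col_mxl _ _) (sub_col_mxr _ _).
exact: submx_trans (sub_col_mxr _ _) (sub_col_mxr _ _).
Qed.
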